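(* The little Bloch space $\beta_0$ embeds almost isometrically into $c_0$, and $\mathcal{K}(\beta_0)$ is an $M$-ideal in $\mathcal{L}(\beta_0)$. In fact, for every Banach space $X$, $\mathcal{K}(X,\beta_0)$ is an $M$-ideal in $\mathcal{L}(X,\beta)$.
   Context: $\beta$ is the Banach space of analytic functions $f$ on the open unit disk $\mathbb{D}\subset\mathbb{C}$ with $\|f\|_\beta:=\sup_{z\in\mathbb{D}}(1-|z|^2)|f(z)|<\infty$, and $\beta_0$ is its closed subspace of those $f$ with $\lim_{|z|\to1}(1-|z|^2)f(z)=0$. (No derivative appears in this definition.) Scalars are complex. $X$ embeds almost isometrically into $Z$ if for every $\varepsilon>0$ there is a subspace $Z_\varepsilon$ of $Z$ whose Banach–Mazur distance to $X$ is less than $1+\varepsilon$. $\mathcal{L}(X,Y)$ is the Banach space of bounded linear operators from $X$ to $Y$, $\mathcal{K}(X,Y)$ its subspace of compact operators, $\mathcal{L}(X)=\mathcal{L}(X,X)$, $\mathcal{K}(X)=\mathcal{K}(X,X)$; $\mathcal{K}(X,\beta_0)$ is regarded as a subspace of $\mathcal{L}(X,\beta)$ via the inclusion $\beta_0\subset\beta$. A closed subspace $J$ of a Banach space $E$ is an $M$-ideal in $E$ if there is a subspace $V\subset E^*$ with $E^*=J^\perp\oplus_1 V$, i.e. every $e^*\in E^*$ is uniquely $e^*=j+v$ with $j\in J^\perp$ (annihilator of $J$), $v\in V$, and $\|e^*\|=\|j\|+\|v\|$. *)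

(* Defs.v *)
From HB Require Import structures.
From mathcomp Require Import all_boot all_order all_algebra.
From mathcomp Require Import all_classical all_reals all_analysis.
From mathcomp Require Import complex.

Set Implicit Arguments.
Unset Strict Implicit.
Unset Printing Implicit Defensive.

Import Order.TTheory GRing.Theory Num.Theory.
Import numFieldNormedType.Exports.

Local Open Scope classical_set_scope.
Local Open Scope ring_scope.
Local Open Scope complex_scope.

(* The scalar field is R[i], and R[i]^o is R[i] as a normed space over itself.
   The norm of a normedModType R[i] takes its values in R[i], where they are
   nonnegative reals; nrm x is the norm of x as an element of R. *)
Definition nrm (R : realType) (V : normedZmodType R[i]) (x : V) : R :=
  complex.Re `|x|.

Section nrm_theory.
Context {R : realType} {V : normedZmodType R[i]}.
Implicit Types x y : V.

Lemma nrmE x : (nrm x)%:C = `|x|.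
Proof.
have := normr_ge0 x; rewrite /nrm; case: (`|x|) => a b.
by rewrite lecE /= => /andP[/eqP -> _].
Qed.

Lemma nrm_ge0 x : 0 <= nrm x.
Proof. by rewrite -lecR nrmE normr_ge0. Qed.

Lemma nrm0 : nrm (0 : V) = 0.
Proof. by rewrite /nrm normr0. Qed.

Lemma nrm_eq0 x : nrm x = 0 -> x = 0.
Proof. by move=> x0; apply: normr0_eq0; rewrite -nrmE x0. Qed.

Lemma nrmD x y : nrm (x + y) <= nrm x + nrm y.
Proof. by rewrite -lecR rmorphD /= !nrmE ler_normD. Qed.

End nrm_theory.

Lemma nrmZ (R : realType) (V : normedModType R[i]) (a : R[i]) (x : V) :
  nrm (a *: x) = nrm a * nrm x.
Proof. by apply: (@complexI R); rewrite rmorphM /= !nrmE normrZ. Qed.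

Lemma cvg_lincomb (K : numFieldType) (V : normedModType K) (T : Type)
    (F : set_system T) {FF : Filter F} {k : K} (f g : T -> V) (a b : V) :
  f @ F --> a -> g @ F --> b -> (fun t => k *: f t + g t) @ F --> k *: a + b.
Proof. by move=> fa gb; apply: cvgD => //; exact: cvgZl_tmp. Qed.

Lemma cvg_seq_norm_ub (K : numFieldType) (V : normedModType K)
    (u : nat -> V) (l : V) :
  u @ \oo --> l -> exists2 M : K, 0 < M & forall n, `|u n| <= M.
Proof.
move=> /cvgP/cvg_seq_bounded/pinfty_ex_gt0[M M0 uM].
by exists M => // n; exact: uM.
Qed.

Section sup_norm.
Context {R : realType} {V : lmodType R[i]} {I : Type}.
Variables (D : set I) (p : I -> V -> R).

Definition sup_norm (v : V) : R := sup [set p i v | i in D].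

Hypothesis D0 : D !=set0.
Hypothesis p_ge0 : forall i v, D i -> 0 <= p i v.
Hypothesis pD : forall i u v, D i -> p i (u + v) <= p i u + p i v.
Hypothesis pZ : forall i a v, D i -> p i (a *: v) = nrm a * p i v.
Hypothesis p_bounded : forall v, exists M, forall i, D i -> p i v <= M.

Lemma sup_norm_ub i v : D i -> p i v <= sup_norm v.
Proof.
move=> Di; apply: ub_le_sup; last by exists i.
by have [M pM] := p_bounded v; exists M => _ [j Dj <-]; exact: pM.
Qed.

Lemma sup_norm_le v M : (forall i, D i -> p i v <= M) -> sup_norm v <= M.
Proof.
move=> pM; apply: ge_sup; last by move=> _ [j Dj <-]; exact: pM.
by have [i Di] := D0; exists (p i v), i.
Qed.

Lemma sup_norm_ge0 v : 0 <= sup_norm v.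
Proof.
have [i Di] := D0; exact: le_trans (p_ge0 v Di) (sup_norm_ub v Di).
Qed.

Lemma sup_normD u v : sup_norm (u + v) <= sup_norm u + sup_norm v.
Proof.
apply: sup_norm_le => i Di.
by rewrite (le_trans (pD _ _ Di))// lerD// sup_norm_ub.
Qed.

Let sup_normZ_le a v : sup_norm (a *: v) <= nrm a * sup_norm v.
Proof.
apply: sup_norm_le => i Di.
by rewrite pZ// ler_wpM2l ?nrm_ge0// sup_norm_ub.
Qed.

Lemma sup_normZ a v : sup_norm (a *: v) = nrm a * sup_norm v.
Proof.
apply/eqP; rewrite eq_le sup_normZ_le /=.
have [->|a0] := eqVneq a 0; first by rewrite nrm0 mul0r sup_norm_ge0.
have na0 : 0 < nrm a.
  rewrite lt_neqAle nrm_ge0 andbT eq_sym.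
  by apply: contra_neq a0 => /nrm_eq0.
rewrite -ler_pdivlMl//; have := sup_normZ_le a^-1 (a *: v).
rewrite scalerA mulVf// scale1r => /le_trans; apply.
suff -> : nrm a^-1 = (nrm a)^-1 by [].
by apply: (@complexI R); rewrite fmorphV /= !nrmE normfV.
Qed.

Lemma sup_norm_eq0 v : sup_norm v = 0 -> forall i, D i -> p i v = 0.
Proof.
move=> v0 i Di; apply/eqP; rewrite eq_le p_ge0// andbT -v0.
exact: sup_norm_ub.
Qed.

Lemma sup_normCD u v :
  (sup_norm (u + v))%:C <= (sup_norm u)%:C + (sup_norm v)%:C.
Proof. by rewrite -rmorphD /= lecR sup_normD. Qed.

Lemma sup_normCZ a v : (sup_norm (a *: v))%:C = `|a| * (sup_norm v)%:C.
Proof. by rewrite sup_normZ rmorphM /= nrmE. Qed.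

End sup_norm.

Section bounded_operators.
Context {R : realType} {X Y : normedModType R[i]}.

Definition bop_pred : {pred X -> Y} :=
  [pred f | `[< linear f /\ continuous f >]].

Lemma bop_pred_submod_closed : submod_closed bop_pred.
Proof.
split.
  rewrite inE; split; last by move=> x; exact: cvg_cst.
  by move=> a x y; rewrite /= scaler0 addr0.
move=> a f g; rewrite !inE => -[fl fc] [gl gc]; split.
  move=> b x y; rewrite !fctE fl gl !scalerDr !scalerA (mulrC a b).
  by rewrite addrACA.
by move=> x; apply: cvgD; [exact: cvgZr (fc x)|exact: gc].
Qed.

HB.instance Definition _ :=
  GRing.isSubmodClosed.Build _ _ bop_pred bop_pred_submod_closed.

Record bop := Bop { bop_fun :> X -> Y ; bop_funP : bop_fun \in bop_pred }.

HB.instance Definition _ := [isSub of bop for bop_fun].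
HB.instance Definition _ := [Choice of bop by <:].
HB.instance Definition _ := [SubChoice_isSubLmodule of bop by <:].

Lemma bop_linear (T : bop) : linear T.
Proof. by case: T => f /=; rewrite inE => -[]. Qed.

HB.instance Definition _ (T : bop) :=
  GRing.isLinear.Build R[i] X Y *:%R T (bop_linear T).

Lemma bop_continuous (T : bop) : continuous T.
Proof. by case: T => f /=; rewrite inE => -[]. Qed.

Let D : set X := [set x | `|x| <= 1].
Let p (x : X) (T : bop) : R := nrm (T x).

Definition opnorm (T : bop) : R :=
  sup [set nrm (T x) | x in [set x : X | `|x| <= 1]].

Let D0 : D !=set0. Proof. by exists 0; rewrite /D/= normr0. Qed.

Let p_bounded (T : bop) : exists M, forall x, D x -> p x T <= M.
Proof.
have /linear_bounded_continuous/linear_boundedP := @bop_continuous T.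
move=> /pinfty_ex_gt0[M M0 TM]; exists (complex.Re M) => x /= x1.
rewrite -lecR /p nrmE; have -> : (complex.Re M)%:C = M.
  by move: M0; case: (M) => a b; rewrite ltcE /= => /andP[/eqP ->].
by rewrite (le_trans (TM x))// ler_piMr// ltW.
Qed.

Let pD x (T S : bop) : D x -> p x (T + S) <= p x T + p x S.
Proof. by move=> _; exact: nrmD. Qed.

Let pZ x a (T : bop) : D x -> p x (a *: T) = nrm a * p x T.
Proof. by move=> _; exact: nrmZ. Qed.

Let p_ge0 x (T : bop) : D x -> 0 <= p x T.
Proof. by move=> _; exact: nrm_ge0. Qed.

Let opnorm_eq0 (T : bop) : (opnorm T)%:C = 0 -> T = 0.
Proof.
move=> /(@complexI R _ 0) T0; apply/val_inj/funext => x /=.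
have Tball (y : X) : `|y| <= 1 -> T y = 0.
  by move=> y1; apply/nrm_eq0/(sup_norm_eq0 p_ge0 p_bounded T0 y1).
have [->|x0] := eqVneq x 0; first by rewrite linear0.
have nx0 : `|x| != 0 by rewrite normr_eq0.
have := Tball (`|x|^-1 *: x); rewrite linearZ /= normrZ normfV normr_id mulVf//.
by move=> /(_ (lexx _)) /eqP; rewrite scaler_eq0 invr_eq0 (negbTE nx0) => /eqP.
Qed.

HB.instance Definition _ := Lmodule_isNormed.Build R[i] bop
  (sup_normCD D0 pD p_bounded) (sup_normCZ D0 p_ge0 pZ p_bounded) opnorm_eq0.

Lemma nrm_bopE (T : bop) : nrm T = opnorm T.
Proof. by []. Qed.

End bounded_operators.
Arguments bop {R} X Y.

Section subspaces.
Context {R : realType} {Z : normedModType R[i]} (W : submodClosed Z).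

Record subspace_of := SubspaceOf { subspace_val :> Z ; _ : subspace_val \in W }.

HB.instance Definition _ := [isSub of subspace_of for subspace_val].
HB.instance Definition _ := [Choice of subspace_of by <:].
HB.instance Definition _ := [SubChoice_isSubLmodule of subspace_of by <:].

Let norm (x : subspace_of) : R[i] := `|val x|.

Let normD (x y : subspace_of) : norm (x + y) <= norm x + norm y.
Proof. exact: ler_normD. Qed.

Let normZ a (x : subspace_of) : norm (a *: x) = `|a| * norm x.
Proof. exact: normrZ. Qed.

Let norm_eq0 (x : subspace_of) : norm x = 0 -> x = 0.
Proof. by move=> /normr0_eq0 x0; exact: val_inj. Qed.

HB.instance Definition _ :=
  Lmodule_isNormed.Build R[i] subspace_of normD normZ norm_eq0.

End subspaces.

Record disk (R : realType) :=
  Disk { disk_val :> R[i] ; disk_valP : nrm disk_val < 1 }.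

Definition disk0 (R : realType) : disk R :=
  @Disk R 0 (eq_ind_r (fun x => x < 1) ltr01 (@nrm0 R R[i])).

Definition pseries_partial (R : realType) (a : nat -> R[i]) (h : R[i])
  : nat -> R[i]^o := series (fun k => a k * h ^+ k : R[i]).

(* Functions on the disk are maps from the type disk R, so that they carry no
   values outside it; f is analytic if near each point of the disk it is the sum
   of a convergent power series centred there. *)
Definition analytic_on_disk (R : realType) (f : disk R -> R[i]^o) : Prop :=
  forall z0 : disk R, exists (r : R) (a : nat -> R[i]), 0 < r /\
    forall z : disk R, nrm (disk_val z - disk_val z0) < r ->
      pseries_partial a (disk_val z - disk_val z0) @ \oo --> f z.

(* The weight is applied to f itself, not to its derivative as in the other
   usual description of the Bloch space. *)
Definition bloch_weight (R : realType) (z : disk R) : R := 1 - nrm (z : R[i]) ^+ 2.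

Section bloch_space.
Context {R : realType}.
Implicit Types f g : disk R -> R[i]^o.

Definition bloch_pred : {pred disk R -> R[i]^o} :=
  [pred f | `[< analytic_on_disk f /\
    exists M : R, forall z, bloch_weight z * nrm (f z) <= M >]].

Lemma bloch_weight_gt0 (z : disk R) : 0 < bloch_weight z.
Proof.
case: z => z z1; rewrite /bloch_weight subr_gt0 /= expr_lt1 ?nrm_ge0 //.
Qed.

Lemma bloch_pred_submod_closed : submod_closed bloch_pred.
Proof.
have w_ge0 z := ltW (@bloch_weight_gt0 z).
split.
  rewrite inE; split.
    move=> z0; exists 1, (fun=> 0); split => // z _.
    rewrite (_ : pseries_partial _ _ = cst 0); first exact: cvg_cst.
    by apply/funext => n; rewrite /pseries_partial /series /= big1// => i _; rewrite mul0r.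
  by exists 0 => z; rewrite nrm0 mulr0.
move=> c f g; rewrite !inE => -[fa [M fM]] [ga [N gN]]; split.
  move=> z0; have [r [a [r0 fr]]] := fa z0; have [s [b [s0 gs]]] := ga z0.
  exists (Num.min r s), (fun n => c * a n + b n); split.
    by rewrite lt_min r0.
  move=> z; rewrite lt_min => /andP[/fr cf /gs cg].
  rewrite (_ : pseries_partial _ _ =
      (fun n => c *: pseries_partial a (disk_val z - disk_val z0) n +
                pseries_partial b (disk_val z - disk_val z0) n)).
    exact: (cvg_lincomb (K := R[i]) (V := R[i]^o) (k := c) cf cg).
  apply/funext => n; rewrite /pseries_partial /series /= scaler_sumr -big_split.
  by apply: eq_bigr => i _; rewrite mulrDl -mulrA.
exists (nrm (c : R[i]^o) * M + N) => z.
apply: le_trans (_ : bloch_weight z * (nrm c * nrm (f z) + nrm (g z)) <= _).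
  by rewrite ler_wpM2l// (le_trans (nrmD _ _))// lerD2r nrmZ.
by rewrite mulrDr mulrCA lerD// ler_wpM2l// nrm_ge0.
Qed.

HB.instance Definition _ :=
  GRing.isSubmodClosed.Build _ _ bloch_pred bloch_pred_submod_closed.

End bloch_space.

Record bloch (R : realType) :=
  Bloch { bloch_fun :> disk R -> R[i]^o ; _ : bloch_fun \in bloch_pred }.

Section bloch_norm.
Context {R : realType}.

HB.instance Definition _ := [isSub of bloch R for @bloch_fun R].
HB.instance Definition _ := [Choice of bloch R by <:].
HB.instance Definition _ := [SubChoice_isSubLmodule of bloch R by <:].

Let p (z : disk R) (f : bloch R) : R := bloch_weight z * nrm (f z).

Definition bloch_norm (f : bloch R) : R :=
  sup [set bloch_weight z * nrm (f z) | z in [set: disk R]].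

Let D0 : [set: disk R] !=set0. Proof. by exists (disk0 R). Qed.

Let p_bounded f : exists M, forall z, [set: disk R] z -> p z f <= M.
Proof.
by case: f => f /[dup]; rewrite {1}inE => -[_ [M fM]] ?; exists M => z _; exact: fM.
Qed.

Let p_ge0 z f : [set: disk R] z -> 0 <= p z f.
Proof. by move=> _; rewrite mulr_ge0 ?nrm_ge0// ltW// bloch_weight_gt0. Qed.

Let pD z f g : [set: disk R] z -> p z (f + g) <= p z f + p z g.
Proof.
by move=> _; rewrite -mulrDr ler_wpM2l ?nrmD// ltW// bloch_weight_gt0.
Qed.

Let pZ z a f : [set: disk R] z -> p z (a *: f) = nrm a * p z f.
Proof. by move=> _; rewrite /p /= [nrm _]nrmZ mulrCA. Qed.

Let bloch_norm_eq0 (f : bloch R) : (bloch_norm f)%:C = 0 -> f = 0.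
Proof.
move=> /(@complexI R _ 0) f0; apply/val_inj/funext => z /=; apply: nrm_eq0.
have /eqP := sup_norm_eq0 p_ge0 p_bounded f0 (I : [set: disk R] z).
by rewrite mulf_eq0 gt_eqF ?bloch_weight_gt0//= => /eqP.
Qed.

HB.instance Definition _ := Lmodule_isNormed.Build R[i] (bloch R)
  (sup_normCD D0 pD p_bounded) (sup_normCZ D0 p_ge0 pZ p_bounded) bloch_norm_eq0.

Lemma nrm_blochE (f : bloch R) : nrm f = bloch_norm f.
Proof. by []. Qed.

(* (1 - |z|^2) f(z) -> 0 as |z| -> 1 *)
Definition vanishes_at_boundary (f : bloch R) : Prop :=
  forall e : R, 0 < e -> exists2 r : R, r < 1 &
    forall z : disk R, r < nrm (z : R[i]) -> bloch_weight z * nrm (f z) < e.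

Definition little_bloch_pred : {pred bloch R} :=
  [pred f | `[< vanishes_at_boundary f >]].

Lemma little_bloch_pred_submod_closed : submod_closed little_bloch_pred.
Proof.
have w_ge0 (z : disk R) := ltW (bloch_weight_gt0 z).
split.
  by rewrite inE => e e0; exists 0 => // z _; rewrite nrm0 mulr0.
move=> c f g; rewrite !inE => f0 g0 e e0.
have c0 : 0 < nrm c + 1 by rewrite ltr_wpDl ?nrm_ge0.
have [r r1 fr] := f0 (e / 2 / (nrm c + 1)) (divr_gt0 (divr_gt0 e0 (ltr0n _ 2)) c0).
have [s s1 gs] := g0 (e / 2) (divr_gt0 e0 (ltr0n _ 2)).
exists (Num.max r s); first by rewrite gt_max r1.
move=> z; rewrite gt_max => /andP[/fr fz /gs gz].
have -> : e = e / 2 + e / 2 by rewrite -splitr.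
apply: le_lt_trans (_ : bloch_weight z * (nrm c * nrm (f z) + nrm (g z)) < _).
  by rewrite ler_wpM2l// (le_trans (nrmD _ _))// lerD2r [leLHS]nrmZ.
rewrite mulrDr ler_ltD// mulrCA; move: fz; rewrite ltr_pdivlMr// => /ltW.
apply: le_trans; rewrite mulrC ler_wpM2l// ?lerDl//.
by rewrite mulr_ge0// nrm_ge0.
Qed.

HB.instance Definition _ := GRing.isSubmodClosed.Build _ _ little_bloch_pred
  little_bloch_pred_submod_closed.

End bloch_norm.
Arguments little_bloch_pred : clear implicits.

Definition little_bloch (R : realType) : normedModType R[i] :=
  subspace_of (little_bloch_pred R).

Section c0_space.
Context {R : realType}.

Definition c0_pred : {pred nat -> R[i]^o} := [pred u | `[< u @ \oo --> 0 >]].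

Lemma c0_pred_submod_closed : submod_closed c0_pred.
Proof.
split; first by rewrite inE; exact: cvg_cst.
move=> a u v; rewrite !inE => u0 v0.
have := cvg_lincomb (K := R[i]) (V := R[i]^o) (k := a) u0 v0.
rewrite scaler0 addr0; exact.
Qed.

HB.instance Definition _ :=
  GRing.isSubmodClosed.Build _ _ c0_pred c0_pred_submod_closed.

Record c0 := C0 { c0_fun :> nat -> R[i]^o ; _ : c0_fun \in c0_pred }.

HB.instance Definition _ := [isSub of c0 for c0_fun].
HB.instance Definition _ := [Choice of c0 by <:].
HB.instance Definition _ := [SubChoice_isSubLmodule of c0 by <:].

Let p (n : nat) (u : c0) : R := nrm (u n).

Definition c0_norm (u : c0) : R := sup [set nrm (u n) | n in [set: nat]].

Let D0 : [set: nat] !=set0. Proof. by exists 0%N. Qed.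

Let p_bounded u : exists M, forall n, [set: nat] n -> p n u <= M.
Proof.
case: u => u u0; have := u0; rewrite inE => ul.
have [M M0 uM] := @cvg_seq_norm_ub R[i] R[i]^o u 0 ul.
exists (complex.Re M) => n _.
rewrite -lecR /p nrmE; have -> : (complex.Re M)%:C = M.
  by move: M0; case: (M) => a b; rewrite ltcE /= => /andP[/eqP ->].
exact: uM.
Qed.

Let p_ge0 n u : [set: nat] n -> 0 <= p n u.
Proof. by move=> _; exact: nrm_ge0. Qed.

Let pD n u v : [set: nat] n -> p n (u + v) <= p n u + p n v.
Proof. by move=> _; exact: nrmD. Qed.

Let pZ n a u : [set: nat] n -> p n (a *: u) = nrm a * p n u.
Proof. by move=> _; exact: (@nrmZ R R[i]^o). Qed.

Let c0_norm_eq0 (u : c0) : (c0_norm u)%:C = 0 -> u = 0.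
Proof.
move=> /(@complexI R _ 0) u0; apply/val_inj/funext => n /=; apply: nrm_eq0.
exact: (sup_norm_eq0 p_ge0 p_bounded u0 (I : [set: nat] n)).
Qed.

HB.instance Definition _ := Lmodule_isNormed.Build R[i] c0
  (sup_normCD D0 pD p_bounded) (sup_normCZ D0 p_ge0 pZ p_bounded) c0_norm_eq0.

Lemma nrm_c0E (u : c0) : nrm u = c0_norm u.
Proof. by []. Qed.

End c0_space.
Arguments c0 : clear implicits.

(* The infimum of ||T|| ||T^-1|| over the isomorphisms T from X onto Y, and
   +oo if there is none *)
Definition banach_mazur (R : realType) (X Y : normedModType R[i]) : \bar R :=
  ereal_inf [set d | exists (T : bop X Y) (S : bop Y X),
    [/\ cancel T S, cancel S T & d = (nrm T * nrm S)%:E]].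

Definition embeds_almost_isometrically (R : realType)
    (X Z : normedModType R[i]) : Prop :=
  forall e : R, 0 < e -> exists W : submodClosed Z,
    (banach_mazur X (subspace_of W) < (1 + e)%:E)%E.

Definition compact_operator (R : realType) (X Y : normedModType R[i])
    (T : bop X Y) : Prop :=
  compact (closure [set T x | x in [set x : X | `|x| <= 1]]).

Definition compact_operators (R : realType) (X Y : normedModType R[i])
  : set (bop X Y) := [set T | compact_operator T].
Arguments compact_operators {R} X Y.

(* K(X, beta_0) as a subset of L(X, beta): relative compactness of the
   image of the unit ball is meant in beta_0. *)
Definition compact_operators_little_bloch (R : realType)
    (X : normedModType R[i]) : set (bop X (bloch R)) :=
  [set T | exists2 S : bop X (little_bloch R),
    compact_operator S & forall x, T x = subspace_val (S x)].
Arguments compact_operators_little_bloch {R} X.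

Definition dual (R : realType) (E : normedModType R[i]) : normedModType R[i] :=
  bop E R[i]^o.

Definition annihilator (R : realType) (E : normedModType R[i]) (J : set E)
  : set (dual E) := [set phi | forall x, J x -> (phi : bop E R[i]^o) x = 0].

Definition M_ideal (R : realType) (E : normedModType R[i]) (J : set E) : Prop :=
  [/\ submod_closed [in J], closed J &
    exists V : set (dual E), submod_closed [in V] /\
      forall phi : dual E, exists j v : dual E,
        [/\ annihilator J j, V v, phi = j + v,
            nrm phi = nrm j + nrm v &
            forall j' v' : dual E, annihilator J j' -> V v' ->
              phi = j' + v' -> j' = j /\ v' = v]].

(* Main.v *)
Require Import Defs.
From HB Require Import structures.
From mathcomp Require Import all_boot all_order all_algebra.
From mathcomp Require Import all_classical all_reals all_analysis.
From mathcomp Require Import complex ring lra.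

(* Sampling (1 - |z|^2) f(z) along a hyperbolically fine sequence tending to the
   boundary maps beta_0 almost isometrically into c_0, because this weighted
   function is uniformly Lipschitz for the hyperbolic distance.

   For the M-ideals, let K be the mean of N dilations f |-> f(r_k z) with
   1 - r_k = 2^-k. Each dilation is compact from beta to beta_0. At a point z
   only boundedly many of the f(r_k z) are far both from f(z) and, once
   weighted, from 0, so K f is up to O(1/N) the convex multiple lam(z) f(z) in
   the weighted norm. Hence |K f + g - K g| <= max(|f|, |g|) + O(1/N), while
   K -> 1 on beta_0; composing operators with K gives the L-projection on the
   dual as a limit along an ultrafilter.

   The Cauchy estimates come from the maximum principle, proved by comparing
   with the lowest-order term of a power series; they give equicontinuity and
   Montel's theorem, the latter for bounded ultrafilters. *)

Set Implicit Arguments.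
Unset Strict Implicit.
Unset Printing Implicit Defensive.

Import Order.TTheory GRing.Theory Num.Theory.
Import numFieldNormedType.Exports.

Local Open Scope classical_set_scope.
Local Open Scope ring_scope.
Local Open Scope complex_scope.

(** * Real-valued norms *)

(** A single dilation would not do: where 1 - |z| is comparable with 1 - r, the value f(rz) is close
    neither to f(z) nor, once weighted, to 0, and this error does not shrink as r tends to 1. With
    dyadic radii the errors at a given z have a sum bounded independently of z and of the number of
    radii, so division by N makes them small. The factor lam(z) does not depend on the function;
    hence the same lam serves f and g, and lam f + (1 - lam) g is a genuine convex combination.

    Analyticity only provides local power series, without control of their radii. A bound on a disc
    of prescribed radius therefore has to come from a global argument, here the maximum principle.

    Compactness is handled as total boundedness, which passes to linear combinations, compositions
    and norm limits of operators without any completeness. The completeness of beta_0 enters once,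
    in [little_bloch_compact].

    Ultrafilter limits exist for every bounded scalar family at once and are linear, so no
    subsequence has to be extracted and no separability is involved. *)

Section nrm_basics.
Context {R : realType} {V : normedZmodType R[i]}.
Implicit Types x y : V.

Lemma nrm_ltE x (e : R) : (nrm x < e) = (`|x| < e%:C).
Proof. by rewrite -nrmE ltcR. Qed.

Lemma nrm_leE x (e : R) : (nrm x <= e) = (`|x| <= e%:C).
Proof. by rewrite -nrmE lecR. Qed.

Lemma nrmN x : nrm (- x) = nrm x.
Proof. by rewrite /nrm normrN. Qed.

Lemma nrm_distC x y : nrm (x - y) = nrm (y - x).
Proof. by rewrite -nrmN opprB. Qed.

Lemma nrmB x y : nrm (x - y) <= nrm x + nrm y.
Proof. by rewrite (le_trans (nrmD _ _))// nrmN. Qed.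

Lemma nrm_dist_le y x : nrm x <= nrm y + nrm (x - y).
Proof. by rewrite -{1}[x](subrKC y) nrmD. Qed.

Lemma nrm_lip x y : `|nrm x - nrm y| <= nrm (x - y).
Proof.
rewrite ler_norml lerBlDl nrm_dist_le andbT.
by rewrite lerNl opprB lerBlDl nrm_distC nrm_dist_le.
Qed.

Lemma nrm_triangle y x z : nrm (x - z) <= nrm (x - y) + nrm (y - z).
Proof. by rewrite (le_trans _ (nrmD _ _))// addrA subrK. Qed.

Lemma nrm_gt0 x : (0 < nrm x) = (x != 0).
Proof.
rewrite lt_neqAle nrm_ge0 andbT eq_sym; apply/idP/idP; apply: contra.
  by move=> /eqP->; rewrite nrm0.
by move=> /eqP/nrm_eq0/eqP.
Qed.

Lemma nrm_sum (I : Type) (s : seq I) (P : pred I) (F : I -> V) :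
  nrm (\sum_(i <- s | P i) F i) <= \sum_(i <- s | P i) nrm (F i).
Proof.
elim/big_rec2 : _ => [|i b a _ ab]; first by rewrite nrm0.
by rewrite (le_trans (nrmD _ _))// lerD2l.
Qed.

End nrm_basics.

Section nrm_complex.
Context {R : realType}.
Implicit Types x y : R[i].

Lemma nrmM x y : nrm (x * y) = nrm x * nrm y.
Proof. by apply: (@complexI R); rewrite rmorphM /= !nrmE normrM. Qed.

Lemma nrm1 : nrm (1 : R[i]) = 1.
Proof. by rewrite /nrm normr1. Qed.

Lemma nrmX x n : nrm (x ^+ n) = nrm x ^+ n.
Proof.
by elim: n => [|n IH]; rewrite ?expr0 ?nrm1// !exprS nrmM IH.
Qed.

Lemma nrmV x : nrm x^-1 = (nrm x)^-1.
Proof. by apply: (@complexI R); rewrite fmorphV /= !nrmE normfV. Qed.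

Lemma nrmR (a : R) : nrm (a%:C : R[i]) = `|a|.
Proof. by rewrite /nrm normc_def /= expr0n /= addr0 sqrtr_sqr. Qed.

Lemma nrm_sqr x : nrm x ^+ 2 = complex.Re x ^+ 2 + complex.Im x ^+ 2.
Proof. by rewrite /nrm normc_def /= sqr_sqrtr// addr_ge0// sqr_ge0. Qed.

Lemma nrm_Re_Im_le x (s : R) : nrm x <= s ->
  complex.Re x \in `[- s, s] /\ complex.Im x \in `[- s, s].
Proof.
move=> xs; have s0 : 0 <= s := le_trans (nrm_ge0 _) xs.
have h : nrm x ^+ 2 <= s ^+ 2 by rewrite lerXn2r// nnegrE// nrm_ge0.
rewrite nrm_sqr in h; rewrite !in_itv/= -!ler_norml.
by split; rewrite -ler_sqr ?nnegrE// real_normK ?num_real// (le_trans _ h)//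
  ?lerDl ?lerDr sqr_ge0.
Qed.

Lemma nrm_le_Re_Im x : nrm x <= `|complex.Re x| + `|complex.Im x|.
Proof.
rewrite -ler_sqr ?nnegrE ?addr_ge0 ?nrm_ge0// nrm_sqr sqrrD !real_normK ?num_real//.
by rewrite -addrAC lerDl mulrn_wge0// mulr_ge0.
Qed.

End nrm_complex.

Section nrm_topology.
Context {R : realType} {V : normedModType R[i]}.
Implicit Types x y : V.

Let ReE (e : R[i]) : 0 < e -> (complex.Re e)%:C = e.
Proof. by case: e => a b; rewrite ltcE /= => /andP[/eqP ->]. Qed.

Let Re_gt0 (e : R[i]) : 0 < e -> 0 < complex.Re e.
Proof. by move=> e0; rewrite -ltcR ReE. Qed.

Lemma nbhs_nrmP x (A : set V) :
  nbhs x A <-> exists2 e : R, 0 < e & forall y, nrm (x - y) < e -> A y.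
Proof.
split => [/nbhs_normP[e /= e0 eA]|[e e0 eA]].
  exists (complex.Re e); first exact: Re_gt0.
  by move=> y; rewrite nrm_ltE ReE//; exact: eA.
apply/nbhs_normP; exists e%:C; first by rewrite /= ltcR.
by move=> y /=; rewrite -nrm_ltE; exact: eA.
Qed.

Lemma cvg_nrmP (T : Type) (F : set_system T) {FF : Filter F} (f : T -> V) l :
  f @ F --> l <-> forall e : R, 0 < e -> \forall t \near F, nrm (l - f t) < e.
Proof.
split => [fl e e0|fl].
  by apply: (fl [set y | nrm (l - y) < e]); apply/nbhs_nrmP; exists e.
move=> A /nbhs_nrmP[e e0 eA]; have := fl e e0; apply: filterS => t.
exact: eA.
Qed.

Lemma cvg_seq_nrmP (f : nat -> V) l : f @ \oo --> l <->
  forall e : R, 0 < e -> exists N, forall n, (N <= n)%N -> nrm (l - f n) < e.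
Proof.
rewrite cvg_nrmP; split => fl e /fl; first by move=> [N _ Nf]; exists N.
by move=> [N Nf]; exists N.
Qed.

Lemma closure_nrmP (A : set V) x :
  closure A x <-> forall e : R, 0 < e -> exists2 y, A y & nrm (x - y) < e.
Proof.
split => [cA e e0|cA B /nbhs_nrmP[e e0 eB]].
  have [|y [Ay xy]] := cA [set y | nrm (x - y) < e]; last by exists y.
  by apply/nbhs_nrmP; exists e.
by have [y Ay xy] := cA e e0; exists y; split => //; exact: eB.
Qed.

Lemma nrm_continuous : continuous (@nrm R V).
Proof.
move=> x; apply/cvgrPdist_lt => e e0; apply/nbhs_nrmP; exists e => //= y xy.
exact: le_lt_trans (nrm_lip _ _) xy.
Qed.

End nrm_topology.

Lemma nrm_cvg_le (R : realType) (V : normedModType R[i]) (T : Type)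
    (F : set_system T) {FF : ProperFilter F} (f : T -> V) l (M : R) :
  f @ F --> l -> (\forall t \near F, nrm (f t) <= M) -> nrm l <= M.
Proof.
move=> /cvg_nrmP fl fM; apply/ler_addgt0Pr => e e0.
have [t [ft lt]] := filter_ex (@filterI _ F _ _ _ fM (fl e e0)).
by rewrite (le_trans (nrm_dist_le (f t) l))// lerD// ltW.
Qed.

Section closed_disc.
Context {R : realType}.

(** A closed subset of the image of the compact square [-s, s]^2. *)
Lemma compact_closed_disc (s : R) : compact [set z : R[i]^o | nrm (z : R[i]) <= s].
Proof.
pose g (p : R * R) : R[i]^o := p.1 +i* p.2.
have gc : continuous g.
  move=> [a b]; apply/cvg_nrmP => e e0.
  near=> p; apply: le_lt_trans (nrm_le_Re_Im _) _ => /=.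
  rewrite (splitr e); apply: ltrD; near: p.
    apply: (@cvgr_dist_lt _ _ _ _ _ _ _ (@cvg_fst R R (nbhs a) (nbhs b) _)).
    by rewrite divr_gt0.
  apply: (@cvgr_dist_lt _ _ _ _ _ _ _ (@cvg_snd R R (nbhs a) (nbhs b) _)).
  by rewrite divr_gt0.
have cS := compact_setX (@segment_compact R (- s) s) (@segment_compact R (- s) s).
have cK := continuous_compact (@continuous_subspaceT _ _ _ g gc) cS.
apply: (subclosed_compact _ cK) => [|z /= /nrm_Re_Im_le[Rez Imz]].
  apply: (@closed_comp _ _ (@nrm R R[i]^o) [set x | x <= s]).
    by move=> z _; exact: nrm_continuous.
  exact: closed_le.
by exists (complex.Re z, complex.Im z) => //=; case: (z).
Unshelve. all: by end_near. Qed.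

(** Used twice in [max_principle]: to maximise a modulus over the disc, and then to find the
    maximiser farthest from 0. *)
Lemma closed_disc_max (g : R[i]^o -> R) (s : R) (A : set R[i]^o) :
  A !=set0 -> closed A -> (forall z, A z -> nrm z <= s) ->
  (forall z (e : R), A z -> 0 < e -> exists2 d : R, 0 < d &
    forall y, A y -> nrm (z - y) < d -> `|g z - g y| < e) ->
  exists2 z, A z & forall y, A y -> g y <= g z.
Proof.
move=> A0 Acl As gc.
have cA : compact A.
  exact: subclosed_compact Acl (@compact_closed_disc s) As.
have gA : {within A, continuous g}.
  apply/subspace_continuousP => z Az.
  apply/cvgrPdist_lt => e e0; have [d d0 dA] := gc z e Az e0.
  by apply/nbhs_nrmP; exists d => // y zy Ay; exact: dA.
have [z zA gz] := compact_EVT_max A0 cA gA; exists z; first by rewrite inE in zA.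
by move=> y Ay; apply: gz; rewrite inE.
Qed.

End closed_disc.

(** * Power series and the maximum principle *)

Section power_series.
Context {R : realType}.
Implicit Types (F G Q : R[i] -> R[i]) (a : nat -> R[i]) (r s : R).

Definition has_pseries F r a := forall h : R[i], nrm h < r ->
  pseries_partial a h @ \oo --> (F h : R[i]^o).

Definition analytic_at F (p : R[i]) :=
  exists r a, 0 < r /\ has_pseries (fun h => F (p + h)) r a.

Lemma pseries_partialE a h n :
  pseries_partial a h n = \sum_(k < n) a k * h ^+ k :> R[i].
Proof. by rewrite /pseries_partial /series /= big_mkord. Qed.

Lemma has_pseriesW F r s a : s <= r -> has_pseries F r a -> has_pseries F s a.
Proof. by move=> sr Fa h hs; apply: Fa; exact: lt_le_trans hs sr. Qed.

Lemma has_pseries_eq F G r a :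
  (forall h, nrm h < r -> F h = G h) -> has_pseries F r a -> has_pseries G r a.
Proof. by move=> FG Fa h hr; rewrite -FG//; exact: Fa. Qed.

Lemma has_pseriesB F G r a b : has_pseries F r a -> has_pseries G r b ->
  has_pseries (fun h => F h - G h) r (fun k => a k - b k).
Proof.
move=> Fa Gb h hr.
rewrite (_ : pseries_partial _ _ =
    (fun n => pseries_partial a h n - pseries_partial b h n)).
  exact: cvgB (Fa h hr) (Gb h hr).
apply/funext => n; apply: etrans (pseries_partialE _ _ _) _.
rewrite [RHS](_ : _ = \sum_(k < n) a k * h ^+ k - \sum_(k < n) b k * h ^+ k).
  by rewrite -sumrB; apply: eq_bigr => k _; rewrite mulrBl.
by rewrite -!pseries_partialE.
Qed.

Lemma has_pseries_poly (P : {poly R[i]}) r : has_pseries (fun h => P.[h]) r (fun k => P`_k).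
Proof.
move=> h _; apply/cvg_seq_nrmP => e e0; exists (size P) => n Pn.
rewrite (_ : pseries_partial _ _ n = P.[h]) ?subrr ?nrm0//.
by rewrite pseries_partialE (horner_coef_wide _ Pn).
Qed.

Lemma geometric_tail (q : R) m n : 0 <= q -> q <= 2^-1 ->
  \sum_(m <= k < n) q ^+ k <= 2 * q ^+ m.
Proof.
move=> q0 q1; have [mn|nm] := leqP m n; last first.
  by rewrite big_geq ?mulr_ge0 ?exprn_ge0// ltnW.
(* The subtracted term makes the induction close: one more summand costs q^n, which is at most 2 q^n
   - 2 q^(n+1) because 2 q <= 1. *)
suff : \sum_(m <= k < n) q ^+ k <= 2 * q ^+ m - 2 * q ^+ n.
  by move=> /le_trans; apply; rewrite lerBlDr lerDl mulr_ge0 ?exprn_ge0.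
rewrite -(subnKC mn); elim: (n - m)%N => [|j IH]; first by rewrite addn0 big_geq// subrr.
rewrite addnS big_nat_recr ?leq_addr//= exprS.
have := exprn_ge0 (m + j) q0; nra.
Qed.

(** Convergence at t = r / 2 bounds the terms a_k t^k, as differences of bounded partial sums. For
    |h| <= s = t / 2 the tail is then dominated by a geometric series of ratio at most 1/2. The
    constants are the same for every order m. *)
Lemma pseries_remainder F r a : 0 < r -> has_pseries F r a ->
  exists s C : R, [/\ 0 < s, s <= r, 0 <= C &
    forall m h, nrm h <= s ->
      nrm (F h - \sum_(k < m) a k * h ^+ k) <= C * (nrm h / s) ^+ m].
Proof.
move=> r0 Fa; pose t := r / 2; have t0 : 0 < t by rewrite divr_gt0.
have tr : nrm (t%:C : R[i]) < r by rewrite nrmR gtr0_norm// /t; lra.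
have [M M0 aM] := cvg_seq_norm_ub (Fa _ tr).
pose C := 2 * complex.Re M.
have at_ k : nrm (a k) * t ^+ k <= C.
  have -> : nrm (a k) * t ^+ k = nrm (a k * t%:C ^+ k).
    by rewrite nrmM nrmX nrmR gtr0_norm.
  have -> : a k * t%:C ^+ k =
      (pseries_partial a t%:C k.+1 : R[i]) - (pseries_partial a t%:C k : R[i]).
    by rewrite !pseries_partialE big_ord_recr/= addrAC subrr add0r.
  have ReM n : nrm (pseries_partial a t%:C n : R[i]) <= complex.Re M.
    rewrite nrm_leE; have := aM n; case: (M) M0 => x y.
    by rewrite ltcE /= => /andP[/eqP ->].
  by rewrite (le_trans (nrmB _ _))// /C mulr2n mulrDl !mul1r lerD.
have C0 : 0 <= C by rewrite (le_trans _ (at_ 0%N))// mulr_ge0 ?nrm_ge0// expr0.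
exists (t / 2), (2 * C); split=> [|||m h hs].
- by rewrite divr_gt0.
- by rewrite /t; lra.
- by rewrite mulr_ge0.
have q0 : 0 <= nrm h / t by rewrite divr_ge0 ?nrm_ge0// ltW.
have q1 : nrm h / t <= 2^-1 by rewrite ler_pdivrMr// mulrC.
apply: le_trans (_ : C * (2 * (nrm h / t) ^+ m) <= _); last first.
  rewrite mulrA (mulrC C); apply: ler_wpM2l; first by rewrite mulr_ge0.
  apply: lerXn2r; rewrite ?nnegrE//.
    by rewrite divr_ge0 ?nrm_ge0// divr_ge0// ltW.
  by rewrite ler_wpM2l ?nrm_ge0// lef_pV2 ?posrE ?divr_gt0//; lra.
have hr : nrm h < r by apply: le_lt_trans hs _; rewrite /t; lra.
pose P : R[i]^o := \sum_(k < m) a k * h ^+ k.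
have cF : (fun n => pseries_partial a h n - P) @ \oo --> (F h : R[i]^o) - P.
  by apply: cvgB; [exact: Fa|exact: cvg_cst].
apply: (nrm_cvg_le cF); exists m => // n /= mn; rewrite pseries_partialE /P.
rewrite -(big_mkord xpredT (fun k => a k * h ^+ k)) (big_cat_nat (leq0n m) mn)//=.
rewrite -(big_mkord xpredT (fun k => a k * h ^+ k)) addrAC subrr add0r.
rewrite (le_trans (nrm_sum _ _ _))// (le_trans _ (ler_wpM2l C0 (geometric_tail m n q0 q1)))//.
rewrite mulr_sumr; apply: ler_sum => k _; rewrite nrmM nrmX expr_div_n mulrCA.
by rewrite mulrC ler_wpM2l ?exprn_ge0 ?nrm_ge0// ler_pdivlMr ?exprn_gt0.
Qed.

Lemma has_pseries_coef0 F r a : 0 < r -> has_pseries F r a -> a 0%N = F 0.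
Proof.
move=> r0 /(pseries_remainder r0)[s [C [s0 _ _ /(_ 1%N 0)]]].
rewrite nrm0 mul0r expr1 mulr0 big_ord1 expr0 mulr1 => /(_ (ltW s0)) F0.
apply/esym/eqP; rewrite -subr_eq0; apply/eqP/nrm_eq0/eqP.
by rewrite eq_le F0 nrm_ge0.
Qed.

Lemma has_pseries_continuous F r a (e : R) : 0 < r -> has_pseries F r a -> 0 < e ->
  exists2 d : R, 0 < d & forall h, nrm h < d -> nrm (F h - F 0) < e.
Proof.
move=> r0 Fa e0; have a0 := has_pseries_coef0 r0 Fa.
have [s [C [s0 _ C0 Fs]]] := pseries_remainder r0 Fa.
exists (Num.min s (e * s / (C + 1))) => [|h].
  by rewrite lt_min s0 divr_gt0 ?mulr_gt0// ltr_wpDl.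
rewrite lt_min => /andP[/ltW /(Fs 1%N)]; rewrite big_ord1 expr0 mulr1 a0 expr1.
move=> /le_lt_trans + he; apply; rewrite mulrA ltr_pdivrMr//.
move: he; rewrite ltr_pdivlMr ?ltr_wpDl// mulrC; apply: le_lt_trans.
by rewrite ler_wpM2r ?nrm_ge0// lerDl.
Qed.

End power_series.

Section maximum_principle.
Context {R : realType}.
Implicit Types (F G Q : R[i] -> R[i]) (a : nat -> R[i]) (r s : R).

Lemma analytic_at_poly (P : {poly R[i]}) p r :
  has_pseries (fun h => P.[p + h]) r (fun k => (P \Po ('X + p%:P))`_k).
Proof.
apply: has_pseries_eq (@has_pseries_poly R (P \Po ('X + p%:P)) r) => h _.
by rewrite horner_comp !hornerE addrC.
Qed.

Lemma near0_mul_lt (A x : R) : 0 <= A -> 0 < x -> \forall t \near 0^'+, t * A < x.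
Proof.
move=> A0 x0; have A1 : 0 < A + 1 by rewrite ltr_wpDl.
near=> t; have t0 : 0 < t by near: t; exact: nbhs_right_gt.
have : t < x / (A + 1) by near: t; apply: nbhs_right_lt; rewrite divr_gt0.
by rewrite ltr_pdivlMr//; apply: lt_trans; rewrite ltr_pM2l// ltrDl.
Unshelve. all: by end_near. Qed.

(* If F differed from c Q, the lowest-order term of F - c Q could be aligned
   with c Q by a choice of direction, and |F| would exceed |c Q| there. *)
Lemma local_max F Q (c : R[i]) r a :
  0 < r -> has_pseries (fun h => F h - c * Q h) r a ->
  (forall e : R, 0 < e -> exists2 d : R, 0 < d &
     forall h, nrm h < d -> nrm (Q h - Q 0) < e) ->
  Q 0 != 0 -> F 0 = c * Q 0 ->
  (forall h, nrm h < r -> nrm (F h) <= nrm c * nrm (Q h)) ->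
  forall h, nrm h < r -> F h = c * Q h.
Proof.
move=> r0 Fa Qc Q0 F0 FQ h hr.
have [c0|c0] := eqVneq c 0.
  apply/eqP; rewrite c0 mul0r -normr_le0 -[0]/(0%:C) -nrm_leE.
  by rewrite (le_trans (FQ _ hr))// c0 nrm0 mul0r.
have [s [C [s0 sr C0 Fs]]] := pseries_remainder r0 Fa.
have [az|/existsNP[m' /eqP am']] := pselect (forall k, a k = 0).
  apply/eqP; rewrite -subr_eq0; apply/eqP.
  apply: (@cvg_unique _ _ (pseries_partial a h @ \oo)); last 2 first.
    exact: (Fa _ hr).
    rewrite (_ : pseries_partial a h = cst 0); first exact: cvg_cst.
    apply/funext => n; apply: etrans (pseries_partialE _ _ _) _.
    by rewrite big1// => i _; rewrite az mul0r.
  exact: norm_hausdorff.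
have [m am mmin] := ex_minnP (ex_intro (fun m => a m != 0) m' am').
have a_lt k : (k < m)%N -> a k = 0.
  by move=> km; apply: contraTeq km => /mmin; rewrite -leqNgt.
have m0 : (0 < m)%N.
  rewrite lt0n; apply: contraNneq am => ->.
  by rewrite (has_pseries_coef0 r0 Fa) F0 subrr.
(* The direction u is chosen so that the term a_m (t u)^m equals t^m c Q(0): it reinforces c Q
   instead of cancelling it. *)
pose u := m.-root (c * Q 0 / a m).
have um : a m * u ^+ m = c * Q 0 by rewrite rootCK// mulrCA mulfV// mulr1.
pose b := nrm (c * Q 0).
have b0 : 0 < b by rewrite nrm_gt0 mulf_neq0.
(* The error budget, with b = |c Q(0)|: |c Q| stays above 7 b / 8, while a gain of t^m |c Q| must be
   absorbed by the variation of c Q, at most t^m b / 8, and by the remainder, made smaller than t^m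
   3 b / 4. This is contradictory since 1/8 + 3/4 = 7/8. *)
have [d d0 Qd] := Qc (nrm (Q 0) / 8) (divr_gt0 (etrans (nrm_gt0 _) Q0) (ltr0n _ 8)).
have u0 := @nrm_ge0 R _ u.
near (0 : R)^'+ => t.
have t0 : 0 < t by near: t; exact: nbhs_right_gt.
have td : t * nrm u < d by near: t; exact: near0_mul_lt.
have ts : t * nrm u < s by near: t; exact: near0_mul_lt.
pose D := C * (nrm u / s) ^+ m.+1.
have tD : t * D < 3 / 4 * b.
  near: t; apply: near0_mul_lt; rewrite ?mulr_gt0//.
  by rewrite mulr_ge0// exprn_ge0// divr_ge0// ltW.
have nh : nrm (t%:C * u) = t * nrm u by rewrite nrmM nrmR gtr0_norm.
have := Fs m.+1 (t%:C * u); rewrite nh => /(_ (ltW ts)).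
rewrite big_ord_recr/= big1 ?add0r => [|i _]; last by rewrite a_lt ?mul0r.
rewrite exprMn mulrCA um => E.
have := FQ (t%:C * u); rewrite nh => /(_ (lt_le_trans ts sr)).
have := Qd (t%:C * u); rewrite nh => /(_ td).
move: E; set Fh := F _; set Qh := Q _ => E QE FE.
have Em : C * (t * nrm u / s) ^+ m.+1 = t ^+ m * (t * D).
  by rewrite /D -mulrA exprMn [t ^+ m.+1]exprS; ring.
have tm0 : 0 < t ^+ m by rewrite exprn_gt0.
have E1 : nrm (Fh - (c * Qh) - t%:C ^+ m * (c * Q 0)) < t ^+ m * (3 / 4 * b).
  by rewrite (le_lt_trans E)// Em ltr_pM2l.
have GE : nrm (c * Qh - c * Q 0) <= b / 8.
  by rewrite -mulrBr nrmM /b nrmM -mulrA ler_wpM2l ?nrm_ge0// ltW.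
have tmE : nrm (t%:C ^+ m : R[i]) = t ^+ m by rewrite nrmX nrmR gtr0_norm.
have E2 : (1 + t ^+ m) * nrm (c * Qh) <=
    nrm Fh + nrm (Fh - c * Qh - t%:C ^+ m * (c * Q 0)) + t ^+ m * (b / 8).
  have -> : 1 + t ^+ m = nrm (1 + t%:C ^+ m : R[i]).
    by rewrite -rmorphXn -(rmorph1 (real_complex R)) -rmorphD /= nrmR gtr0_norm// addr_gt0.
  rewrite -nrmM; have -> : (1 + t%:C ^+ m) * (c * Qh) =
    Fh - (Fh - c * Qh - t%:C ^+ m * (c * Q 0)) + t%:C ^+ m * (c * Qh - c * Q 0).
    by ring.
  rewrite (le_trans (nrmD _ _))// lerD ?nrmB// nrmM tmE.
  by rewrite ler_wpM2l// ltW.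
have bE : b <= nrm (c * Qh) + b / 8.
  by rewrite (le_trans (nrm_dist_le (c * Qh) _))// lerD2l nrm_distC.
move: E1 E2 bE FE; rewrite -[nrm c * nrm Qh]nrmM.
move: (nrm (_ - _ - _)) (nrm Fh) (nrm (c * Qh)) => e f g E1 E2 bE FE.
exfalso; move: E1; apply/negP; rewrite -leNgt.
move: E2 bE FE tm0; move: (t ^+ m) => x; nra.
Unshelve. all: by end_near. Qed.

End maximum_principle.

Section maximum_principle_disc.
Context {R : realType}.
Implicit Types (F G Q : R[i] -> R[i]) (a : nat -> R[i]) (r s : R).

Lemma analytic_at_continuous F p (e : R) : analytic_at F p -> 0 < e ->
  exists2 d : R, 0 < d & forall h, nrm h < d -> nrm (F (p + h) - F p) < e.
Proof.
move=> [r [a [r0 Fa]]] e0; have [d d0 Fd] := has_pseries_continuous r0 Fa e0.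
by exists d => // h /Fd; rewrite addr0.
Qed.

(** The value [a n] at 0 removes the singularity of F(h) / h^n when the coefficients of F below [n]
    vanish. *)
Definition divide_power F a n : R[i] -> R[i] :=
  fun h => if h == 0 then a n else F h / h ^+ n.

Lemma has_pseries_divide_power F a n r : has_pseries F r a ->
  (forall k, (k < n)%N -> a k = 0) ->
  has_pseries (divide_power F a n) r (fun k => a (n + k)%N).
Proof.
move=> Fa an h hr; rewrite /divide_power; have [->|h0] := eqVneq h 0.
  apply/cvg_seq_nrmP => e e0; exists 1%N => -[//|N] _.
  rewrite (_ : pseries_partial _ _ _ = a n) ?subrr ?nrm0//.
  apply: etrans (pseries_partialE _ _ _) _.
  rewrite big_ord_recl big1 => [|i _]; first by rewrite expr0 mulr1 addn0 addr0.
  by rewrite expr0n /= mulr0.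
rewrite mulrC.
rewrite (_ : pseries_partial _ _ =
    (fun N => (h ^+ n)^-1 *: pseries_partial a h (n + N))).
  apply: (@cvgZl_tmp R[i] R[i]^o).
  apply/cvg_seq_nrmP => e e0; have /cvg_seq_nrmP/(_ e e0)[N NF] := Fa h hr.
  by exists N => k Nk; apply: NF; rewrite (leq_trans Nk)// leq_addl.
apply/funext => N; apply: etrans (pseries_partialE _ _ _) _.
rewrite [RHS](_ : _ = (h ^+ n)^-1 * \sum_(k < n + N) a k * h ^+ k :> R[i]).
  rewrite big_split_ord /=.
  have -> : \sum_(k < n) a k * h ^+ k = 0.
    by rewrite big1// => k _; rewrite an ?mul0r.
  rewrite add0r mulr_sumr; apply: eq_bigr => k _.
  by rewrite exprD mulrCA mulKf ?expf_neq0.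
by rewrite -pseries_partialE.
Qed.

Lemma divide_power_continuous F a n r p (e : R) : 0 < r -> has_pseries F r a ->
  (forall k, (k < n)%N -> a k = 0) -> analytic_at F p -> 0 < e ->
  exists2 d : R, 0 < d & forall h, nrm h < d ->
    nrm (divide_power F a n (p + h) - divide_power F a n p) < e.
Proof.
move=> r0 Fa an Fp e0; have [->|p0] := eqVneq p 0.
  have [d d0 Fd] := has_pseries_continuous r0 (has_pseries_divide_power Fa an) e0.
  by exists d => // h; rewrite add0r; exact: Fd.
pose g : R[i]^o -> R[i]^o := fun h => F (p + h) / (p + h) ^+ n.
have Hc H : analytic_at H p ->
    (fun h => H (p + h) : R[i]^o) @ (0 : R[i]^o) --> (H p : R[i]^o).
  move=> Hp; apply/(@cvg_nrmP R R[i]^o _ _ (nbhs_filter (0 : R[i]^o))) => e' e'0.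
  have [d d0 Hd] := analytic_at_continuous Hp e'0.
  by apply/nbhs_nrmP; exists d => // h; rewrite sub0r nrmN nrm_distC; exact: Hd.
have Xp : analytic_at (fun h => 'X^n.[h]) p.
  by exists 1; eexists; split; last exact: analytic_at_poly.
have pn : 'X^n.[p] != 0 by rewrite hornerXn expf_neq0.
have gc : g @ (0 : R[i]^o) --> (F p / p ^+ n : R[i]^o).
  have cX := @cvgV R[i] _ _ (nbhs_filter (0 : R[i]^o)) _ _ pn (Hc _ Xp).
  have := @cvgM R[i] _ _ (nbhs_filter (0 : R[i]^o)) _ _ _ _ (Hc _ Fp) cX.
  rewrite hornerXn (_ : _ \* _ = g)//; apply/funext => h.
  by rewrite /g /= hornerXn.
have /(_ e e0)/nbhs_nrmP[d d0 gd] :=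
  (@cvg_nrmP R R[i]^o _ _ (nbhs_filter (0 : R[i]^o)) _ _).1 gc.
exists (Num.min d (nrm p)) => [|h]; first by rewrite lt_min d0 nrm_gt0.
rewrite lt_min => /andP[hd hp]; rewrite /divide_power (negbTE p0).
have -> : (p + h == 0) = false.
  by apply/negbTE; apply: contraTneq hp => /eqP; rewrite addr_eq0 => /eqP->;
     rewrite nrmN ltxx.
have := gd h; rewrite sub0r nrmN => /(_ hd); rewrite nrm_distC.
exact.
Qed.

Lemma has_pseriesBZ c F Q r a b : has_pseries F r a -> has_pseries Q r b ->
  has_pseries (fun h => F h - c * Q h) r (fun k => a k - c * b k).
Proof.
move=> Fa Qb; apply: (has_pseriesB Fa) => h hr.
rewrite (_ : pseries_partial _ _ = (fun n => c *: pseries_partial b h n)).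
  exact: (@cvgZl_tmp R[i] R[i]^o) (Qb h hr).
apply/funext => n; apply: etrans (pseries_partialE _ _ _) _.
rewrite [RHS](_ : _ = c * \sum_(k < n) b k * h ^+ k :> R[i]).
  by rewrite mulr_sumr; apply: eq_bigr => k _; rewrite mulrA.
by rewrite -pseries_partialE.
Qed.

(** A Schwarz lemma of order n. Let G = F / h^n and take, among the maximisers of |G| on the closed
    disc, one of largest modulus. Inside the disc G would be constant near it, and a maximiser
    farther out would exist. So it lies on the circle, where |G| <= M / s^n. *)
Lemma max_principle F s rho n a r (M : R) : 0 < s -> s < rho ->
  (forall p, nrm p < rho -> analytic_at F p) ->
  0 < r -> has_pseries F r a -> (forall k, (k < n)%N -> a k = 0) ->
  (forall h, nrm h = s -> nrm (F h) <= M) ->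
  nrm (a n) * s ^+ n <= M /\
  forall h, nrm h <= s -> nrm (F h) <= M * (nrm h / s) ^+ n.
Proof.
move=> s0 srho Fan r0 Fa an FM.
pose G := divide_power F a n.
have FG h : F h = G h * h ^+ n.
  rewrite /G /divide_power; case: eqVneq => [->|h0]; last by rewrite divfK ?expf_neq0.
  rewrite -(has_pseries_coef0 r0 Fa) expr0n.
  by case: n an {G} => [|n] an; rewrite /= ?mulr1// mulr0 an.
have Gc p (e : R) : nrm p <= s -> 0 < e -> exists2 d : R, 0 < d &
    forall h, nrm h < d -> nrm (G (p + h) - G p) < e.
  move=> ps e0; apply: (divide_power_continuous r0 Fa an _ e0).
  exact: Fan (le_lt_trans ps srho).
pose A : set R[i]^o := [set z : R[i]^o | nrm (z : R[i]) <= s].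
have As z : A z -> nrm z <= s by [].
have Acl : closed A.
  apply: compact_closed; first exact: norm_hausdorff.
  exact: compact_closed_disc.
have A0 : A !=set0 by exists 0; rewrite /A /= nrm0 ltW.
have [z1 Az1 Gz1] : exists2 z, A z & forall y, A y -> nrm (G y) <= nrm (G z).
  apply: (closed_disc_max A0 Acl As) => z e Az e0.
  have [d d0 Gd] := Gc z e Az e0; exists d => // y Ay zy.
  have := Gd (y - z); rewrite nrm_distC => /(_ zy); rewrite subrKC distrC.
  exact/le_lt_trans/nrm_lip.
pose B : set R[i]^o := [set z : R[i]^o | A z /\ nrm (G z) = nrm (G z1)].
have B0 : B !=set0 by exists z1.
have Bs z : B z -> nrm z <= s by case.
have Bcl : closed B.
  move=> z /closure_nrmP Bz.
  have Az : A z.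
    by apply: Acl; apply/closure_nrmP => e /Bz[y [Ay _] zy]; exists y.
  split=> //; apply/eqP; rewrite eq_le Gz1//=; apply/ler_addgt0Pr => e e0.
  have [d d0 Gd] := Gc z e Az e0; have [y [Ay Gy] zy] := Bz d d0.
  rewrite -Gy (le_trans (nrm_dist_le (G z) _))// lerD2l.
  rewrite ltW//; have := Gd (y - z); rewrite subrKC; apply.
  by rewrite nrm_distC.
have [z2 [Az2 Gz2 z2m]] : exists z2 : R[i], [/\ nrm z2 <= s,
    nrm (G z2) = nrm (G z1) & forall y : R[i], nrm y <= s ->
    nrm (G y) = nrm (G z1) -> nrm y <= nrm z2].
  have [z2 [Az2 Gz2] z2m] : exists2 z, B z & forall y, B y -> nrm y <= nrm z.
    apply: (closed_disc_max B0 Bcl Bs) => z e Bz e0; exists e => // y By.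
    exact/le_lt_trans/nrm_lip.
  by exists z2; split=> // y ys Gy; apply: z2m.
have z2s : nrm z2 = s.
  apply/eqP; rewrite eq_le Az2 /= leNgt; apply/negP => z2s.
  (* At 0, G has the shifted series and is compared with a constant. Elsewhere F itself is compared
     with G(z2) h^n, so that no quotient of power series has to be expanded; the radius is kept
     below |z2| so that h^n can be cancelled. *)
  have [d d0 Gd] : exists2 d : R, 0 < d & forall h, nrm h < d -> G (z2 + h) = G z2.
    have [z20|z20] := eqVneq z2 0.
      have Gr := has_pseries_divide_power Fa an.
      have c1 := @has_pseries_poly R 1 (Num.min r s).
      have mr : Num.min r s <= r by rewrite ge_min lexx.
      have Ga := has_pseriesBZ (c := G z2) (has_pseriesW mr Gr) c1.
      exists (Num.min r s) => [|h hm]; first by rewrite lt_min r0.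
      have := local_max _ Ga _ _ _ _ hm; rewrite !hornerE /= z20 add0r; apply.
      + by rewrite lt_min r0.
      + by move=> e e0; exists 1 => // h' _; rewrite !hornerE subrr nrm0.
      + exact: oner_neq0.
      + by [].
      + move=> h'; rewrite lt_min => /andP[_ /ltW h's]; rewrite !hornerE ?nrm1 ?mulr1.
        by rewrite -z20 Gz2; exact: Gz1.
    have [r' [b [r'0 Fb]]] := Fan z2 (lt_trans z2s srho).
    pose r2 := Num.min r' (Num.min (s - nrm z2) (nrm z2)).
    have r20 : 0 < r2 by rewrite !lt_min r'0 subr_gt0 z2s nrm_gt0.
    have r2r' : r2 <= r' by rewrite ge_min lexx.
    have Ga := has_pseriesBZ (c := G z2) (has_pseriesW r2r' Fb)
      (@analytic_at_poly R 'X^n z2 r2).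
    exists r2 => // h hr2.
    have zh0 : z2 + h != 0.
      apply: contraTneq hr2 => /eqP; rewrite addr_eq0 => /eqP zh.
      by rewrite -leNgt -[nrm h]nrmN -zh !ge_min lexx !orbT.
    apply: (mulIf (expf_neq0 n zh0)); rewrite -FG.
    have := local_max r20 Ga _ _ _ _ hr2; rewrite !hornerE; apply.
    + move=> e e0; have := @analytic_at_continuous (fun h => 'X^n.[h]) z2 e _ e0.
      case=> [|d' d'0 dX]; last by exists d' => // h' /dX; rewrite !hornerE.
      by exists 1; eexists; split; last exact: analytic_at_poly.
    + by rewrite ?addr0 expf_neq0.
    + by rewrite ?addr0 FG.
    + move=> h'; rewrite !lt_min => /and3P[_ h's _]; rewrite !hornerE FG nrmM.
      rewrite ler_wpM2r ?nrm_ge0// Gz2; apply: Gz1.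
      by rewrite /A /= (le_trans (nrmD _ _))// -lerBrDl ltW.
  (* A small step outwards: radially along z2, or along the positive reals if z2 = 0. *)
  have [h hd hz] : exists2 h : R[i], nrm h < Num.min d (s - nrm z2) &
      nrm z2 < nrm (z2 + h).
    have m0 : 0 < Num.min d (s - nrm z2) by rewrite lt_min d0 subr_gt0.
    have [z20|z20] := eqVneq z2 0.
      exists (Num.min d (s - nrm z2) / 2)%:C.
        by rewrite nrmR gtr0_norm ?divr_gt0// ltr_pdivrMr// ltr_pMr// ltr1n.
      rewrite [X in nrm X < _]z20 nrm0 [X in X + _]z20 add0r nrmR.
      by rewrite normr_gt0 gt_eqF// divr_gt0.
    pose t := Num.min d (s - nrm z2) / 2 / nrm z2.
    have t0 : 0 < t by rewrite !divr_gt0// nrm_gt0.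
    exists (t%:C * z2).
      rewrite nrmM nrmR gtr0_norm// divfK ?gt_eqF ?nrm_gt0//.
      by rewrite ltr_pdivrMr// ltr_pMr// ltr1n.
    rewrite -[X in X + _]mul1r -mulrDl nrmM -[1]/(1%:C) -rmorphD /= nrmR.
    by rewrite gtr0_norm ?addr_gt0// ltr_pMl ?nrm_gt0// ltrDl.
  suff : nrm (z2 + h) <= nrm z2 by rewrite leNgt hz.
  apply: z2m.
    rewrite (le_trans (nrmD _ _))// -lerBrDl.
    by move: hd; rewrite lt_min => /andP[_ /ltW].
  by rewrite Gd//; move: hd; rewrite lt_min => /andP[].
have Gs h : nrm h <= s -> nrm (G h) * s ^+ n <= M.
  move=> hs; rewrite (le_trans _ (FM _ z2s))// FG nrmM nrmX z2s.
  by rewrite ler_wpM2r ?exprn_ge0 ?(ltW s0)// Gz2; exact: Gz1.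
split=> [|h hs].
  by have := Gs 0; rewrite /G /divide_power eqxx; apply; rewrite nrm0 ltW.
rewrite FG nrmM nrmX expr_div_n mulrA ler_pdivlMr ?exprn_gt0//.
by rewrite mulrAC ler_wpM2r ?exprn_ge0 ?nrm_ge0// Gs.
Qed.

End maximum_principle_disc.

(** * Cauchy estimates for Taylor coefficients and remainders *)

Section cauchy_estimates.
Context {R : realType}.
Implicit Types (F : R[i] -> R[i]) (s : R).

(* The remainder estimate for n bounds the coefficient a n, and so the next
   remainder on the circle |h| = s; the maximum principle then propagates it
   to the disc with the right order of vanishing at 0. *)
Lemma cauchy_estimates F s rho (M : R) : 0 < s -> s < rho ->
  (forall p, nrm p < rho -> analytic_at F p) ->
  (forall h, nrm h <= s -> nrm (F h) <= M) ->
  exists a : nat -> R[i], forall n, nrm (a n) * s ^+ n <= M * 2 ^+ n /\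
    forall h, nrm h <= s ->
      nrm (F h - \sum_(k < n) a k * h ^+ k) <= M * (2 * (nrm h / s)) ^+ n.
Proof.
move=> s0 srho Fan FM.
have [r [a [r0 Fa0]]] : analytic_at F 0.
  by apply: Fan; rewrite nrm0 (lt_trans s0).
have Fa : has_pseries F r a.
  by apply: has_pseries_eq Fa0 => h _; rewrite add0r.
exists a; pose P n : {poly R[i]} := \poly_(k < n) a k.
have PE n h : (P n).[h] = \sum_(k < n) a k * h ^+ k by rewrite horner_poly.
pose b n k := a k - (P n)`_k.
have b_lt n k : (k < n)%N -> b n k = 0.
  by move=> kn; rewrite /b coef_poly kn subrr.
have FP n : has_pseries (fun h => F h - (P n).[h]) r (b n).
  exact: has_pseriesB Fa (@has_pseries_poly R (P n) r).
have FPan n p : nrm p < rho -> analytic_at (fun h => F h - (P n).[h]) p.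
  move=> /Fan[r' [c [r'0 Fc]]]; exists r'; eexists; split; first exact: r'0.
  exact: has_pseriesB Fc (@analytic_at_poly R (P n) p r').
have s_unit h : nrm h = s -> nrm h / s = 1 by move=> ->; rewrite divff ?gt_eqF.
have aM n : (forall h, nrm h = s -> nrm (F h - (P n).[h]) <= M * 2 ^+ n) ->
    nrm (a n) * s ^+ n <= M * 2 ^+ n /\
    forall h, nrm h <= s -> nrm (F h - (P n).[h]) <= M * (2 * (nrm h / s)) ^+ n.
  move=> FPM; have := max_principle s0 srho (@FPan n) r0 (FP n) (@b_lt n) FPM.
  rewrite {1}/b coef_poly ltnn subr0 => -[-> Mh]; split => // h hs.
  by rewrite exprMn mulrA; exact: Mh.
have FPM n : forall h, nrm h = s -> nrm (F h - (P n).[h]) <= M * 2 ^+ n.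
  elim: n => [|n IH] h hs.
    by rewrite PE big_ord0 subr0 expr0 mulr1 FM// hs.
  (* On the circle the old remainder and the new term are both at most M 2^n; adding them is what
     costs a factor 2 per degree. *)
  rewrite PE big_ord_recr/= -PE opprD addrA (le_trans (nrmB _ _))//.
  rewrite exprS (_ : _ * _ = M * 2 ^+ n + M * 2 ^+ n); last by ring.
  by rewrite lerD ?IH// nrmM nrmX hs; have [] := aM n IH.
move=> n; have [an Fn] := aM n (FPM n); split => // h hs.
by rewrite -PE; exact: Fn.
Qed.

End cauchy_estimates.

(** * Estimates in the space beta *)

Section disk_extension.
Context {R : realType}.
Implicit Types (f : disk R -> R[i]^o) (z : disk R).

(* Junk value 0 outside the disk. *)
Definition disk_ext f (z : R[i]) : R[i] :=
  if pselect (nrm z < 1) is left z1 then f (Disk z1) else 0.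

Lemma disk_val_inj : injective (@disk_val R).
Proof. by move=> [x px] [y py] /= xy; subst y; congr Disk; exact: Prop_irrelevance. Qed.

Lemma disk_extE f z : disk_ext f z = f z.
Proof.
rewrite /disk_ext; case: pselect => [z1|/(_ (disk_valP z))//].
by congr f; exact: disk_val_inj.
Qed.

Lemma analytic_disk_ext f p : analytic_on_disk f -> nrm p < 1 ->
  analytic_at (disk_ext f) p.
Proof.
move=> fan p1; have [r [a [r0 fa]]] := fan (Disk p1).
exists (Num.min r (1 - nrm p)), a; split; first by rewrite lt_min r0 subr_gt0.
move=> h; rewrite lt_min ltrBrDl => /andP[hr hp].
have ph1 : nrm (p + h) < 1 by exact: le_lt_trans (nrmD _ _) hp.
have phE : disk_val (Disk ph1) - disk_val (Disk p1) = h by rewrite /= addrC addKr.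
have := fa (Disk ph1); rewrite phE => /(_ hr).
by rewrite -disk_extE.
Qed.

End disk_extension.

Lemma bloch_lincombE (R : realType) (a : R[i]) (f g : bloch R) z :
  (a *: f + g : bloch R) z = a *: f z + g z.
Proof. by []. Qed.

Lemma bloch_valD (R : realType) (f g : bloch R) z : (f + g) z = f z + g z.
Proof. by []. Qed.

Lemma bloch_valB (R : realType) (f g : bloch R) z : (f - g) z = f z - g z.
Proof. by []. Qed.

Lemma bloch_valZ (R : realType) (a : R[i]) (f : bloch R) z :
  (a *: f : bloch R) z = a * f z.
Proof. by []. Qed.

Section bloch_estimates.
Context {R : realType}.
Implicit Types (f : bloch R) (z : disk R).

Lemma bloch_le_nrm f z : bloch_weight z * nrm (f z) <= nrm f.
Proof.
rewrite nrm_blochE; apply: ub_le_sup; last by exists z.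
case: f => f /[dup]; rewrite {1}inE => -[_ [M fM]] ?; exists M => _ [y _ <-].
exact: fM.
Qed.

Lemma bloch_nrm_le f (M : R) :
  (forall z, bloch_weight z * nrm (f z) <= M) -> nrm f <= M.
Proof.
move=> fM; rewrite nrm_blochE; apply: ge_sup => [|_ [z _ <-]//].
by exists (bloch_weight (disk0 R) * nrm (f (disk0 R))), (disk0 R).
Qed.

Lemma bloch_analytic f : analytic_on_disk f.
Proof. by case: f => f /=; rewrite inE => -[]. Qed.

Lemma disk_dist_gt0 z : 0 < 1 - nrm (z : R[i]).
Proof. by rewrite subr_gt0; exact: disk_valP. Qed.

Lemma bloch_weight_factor z :
  bloch_weight z = (1 - nrm (z : R[i])) * (1 + nrm (z : R[i])).
Proof. by rewrite /bloch_weight; ring. Qed.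

Lemma bloch_weight_ge z : 1 - nrm (z : R[i]) <= bloch_weight z.
Proof.
by rewrite bloch_weight_factor ler_pMr ?disk_dist_gt0// lerDl nrm_ge0.
Qed.

Lemma bloch_weight_le z : bloch_weight z <= 2 * (1 - nrm (z : R[i])).
Proof.
rewrite bloch_weight_factor mulrC ler_wpM2r ?(ltW (disk_dist_gt0 _))//.
by have := disk_valP z; lra.
Qed.

(** On the disc of radius s about z the distance to the boundary is still at least s, hence so is
    the weight, and |f| is at most its norm divided by s. The Cauchy estimates apply with this
    bound. *)
Lemma bloch_taylor f z : exists a : nat -> R[i],
  let s := (1 - nrm (z : R[i])) / 2 in
  forall n, nrm (a n) * s ^+ n <= nrm f / s * 2 ^+ n /\
    forall y : disk R, nrm (disk_val y - disk_val z) <= s ->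
      nrm (f y - \sum_(k < n) a k * (disk_val y - disk_val z) ^+ k : R[i]) <=
        nrm f / s * (2 * (nrm (disk_val y - disk_val z) / s)) ^+ n.
Proof.
pose s := (1 - nrm (z : R[i])) / 2; have z1 := disk_dist_gt0 z.
have s0 : 0 < s by rewrite divr_gt0.
pose F h := disk_ext f (disk_val z + h).
have Fan p : nrm p < 1 - nrm (z : R[i]) -> analytic_at F p.
  rewrite ltrBrDl => zp.
  have [|r [a [r0 fa]]] := @analytic_disk_ext R f (disk_val z + p) (@bloch_analytic f).
    exact: le_lt_trans (nrmD _ _) zp.
  exists r, a; split; first exact: r0.
  by apply: has_pseries_eq fa => h _; rewrite /F addrA.
have FM h : nrm h <= s -> nrm (F h) <= nrm f / s.
  move=> hs; rewrite /F /disk_ext; case: pselect => [zh1|_]; last first.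
    by rewrite nrm0 divr_ge0 ?nrm_ge0// ltW.
  rewrite ler_pdivlMr// mulrC; apply: le_trans (bloch_le_nrm f (Disk zh1)).
  rewrite ler_wpM2r ?nrm_ge0//; apply: le_trans (bloch_weight_ge _) => /=.
  have := @nrmD R R[i] (disk_val z) h; move: hs; rewrite /s; lra.
have ss : s < 1 - nrm (z : R[i]) by rewrite /s; lra.
have [a Fa] := cauchy_estimates s0 ss Fan FM.
exists a => s' n; have [an Fn] := Fa n; split => // y yz.
by have := Fn _ yz; rewrite /F subrKC disk_extE.
Qed.

(** The Taylor remainder of order one. With t = 1 - |z|, the constant 16 collects the weight, at
    most 2 t, the bound 2 |f| / t and the factor 4 d / t for d = |y - z|. *)
Lemma bloch_lip f z y : nrm (disk_val y - disk_val z) <= (1 - nrm (z : R[i])) / 2 ->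
  bloch_weight z * nrm (f y - f z) <=
    16 * (nrm (disk_val y - disk_val z) / (1 - nrm (z : R[i]))) * nrm f.
Proof.
move=> yz; have [a fa] := bloch_taylor f z.
have s0 := disk_dist_gt0 z; have [_ f1] := fa 1%N.
have a0 : a 0%N = f z.
  have := f1 z; rewrite subrr nrm0 mul0r mulr0 expr1 mulr0 big_ord1 expr0 mulr1.
  rewrite divr_ge0 ?(ltW s0)// => /(_ isT) fz.
  apply/esym/eqP; rewrite -subr_eq0; apply/eqP/nrm_eq0/eqP.
  by rewrite eq_le fz nrm_ge0.
have := f1 y yz; rewrite big_ord1 expr0 mulr1 a0 expr1 => fy.
have := bloch_weight_le z; set w := bloch_weight z; set t := 1 - _ => wt.
apply: le_trans (_ : 2 * t * (nrm f / (t / 2) *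
    (2 * (nrm (disk_val y - disk_val z) / (t / 2)))) <= _).
  by apply: ler_pM => //; rewrite ?nrm_ge0// ltW// bloch_weight_gt0.
have t0 : t != 0 by rewrite gt_eqF.
rewrite le_eqVlt; apply/orP; left; apply/eqP; field.
by [].
Qed.

End bloch_estimates.

(** * Bounded operators and total boundedness *)

Section bounded_operator_norm.
Context {R : realType} {X Y : normedModType R[i]}.
Implicit Types (T : bop X Y).

Lemma bop_predP (f : X -> Y) (M : R) : linear f ->
  (forall x, nrm (f x) <= M * nrm x) -> f \in bop_pred.
Proof.
move=> fl fM; rewrite inE; split => // x; apply/cvg_nrmP => e e0.
have M1 : 0 < `|M| + 1 by rewrite ltr_wpDl.
apply/nbhs_nrmP; exists (e / (`|M| + 1)) => [|y]; first by rewrite divr_gt0.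
rewrite ltr_pdivlMr// mulrC; apply: le_lt_trans.
have -> : f x - f y = f (x - y).
  by rewrite [x - y]addrC -[- y]scaleN1r fl scaleN1r [RHS]addrC.
rewrite (le_trans (fM _))// ler_wpM2r ?nrm_ge0// (le_trans (ler_norm _))//.
by rewrite lerDl.
Qed.

Lemma bop_linearP T (a : R[i]) x y : T (a *: x + y) = a *: T x + T y.
Proof. exact: bop_linear. Qed.

Lemma bop_ball_le T x : nrm x <= 1 -> nrm (T x) <= nrm T.
Proof.
move=> x1; rewrite nrm_bopE; apply: ub_le_sup; last first.
  by exists x => //=; rewrite -(rmorph1 (real_complex R)) -nrm_leE.
have [M TM] : exists M : R, forall y, nrm y <= 1 -> nrm (T y) <= M.
  have /linear_bounded_continuous/linear_boundedP := @bop_continuous _ _ _ T.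
  move=> /pinfty_ex_gt0[M M0 TM]; exists (complex.Re M) => y y1.
  have ME : (complex.Re M)%:C = M.
    by move: M0; case: (M) => a b; rewrite ltcE /= => /andP[/eqP ->].
  rewrite nrm_leE ME (le_trans (TM y))// ler_piMr ?(ltW M0)//.
  by rewrite -(rmorph1 (real_complex R)) -nrm_leE.
exists M => _ [y /= y1 <-]; apply: TM.
by rewrite nrm_leE (rmorph1 (real_complex R)).
Qed.

Lemma bop_le_nrm T x : nrm (T x) <= nrm T * nrm x.
Proof.
have [->|x0] := eqVneq x 0; first by rewrite linear0 !nrm0 mulr0.
have nx : 0 < nrm x by rewrite nrm_gt0.
have := @bop_ball_le T ((nrm x)^-1%:C *: x).
rewrite nrmZ linearZ/= nrmZ nrmR gtr0_norm ?invr_gt0// mulVf ?gt_eqF//.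
by rewrite mulrC -ler_pdivlMr ?invr_gt0// invrK; apply.
Qed.

Lemma bop_nrm_le T (M : R) :
  (forall x, nrm x <= 1 -> nrm (T x) <= M) -> nrm T <= M.
Proof.
move=> TM; rewrite nrm_bopE; apply: ge_sup => [|_ [x /= x1 <-]].
  by exists (nrm (T 0)), 0 => //=; rewrite normr0.
by apply: TM; rewrite nrm_leE (rmorph1 (real_complex R)).
Qed.

End bounded_operator_norm.

Lemma subspace_lincombE (R : realType) (Z : normedModType R[i])
    (W : submodClosed Z) (a : R[i]) (f g : subspace_of W) :
  subspace_val (a *: f + g) = a *: subspace_val f + subspace_val g.
Proof. by []. Qed.

Lemma subspace_valB (R : realType) (Z : normedModType R[i])
    (W : submodClosed Z) (f g : subspace_of W) :
  subspace_val (f - g) = subspace_val f - subspace_val g.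
Proof. by []. Qed.

Lemma subspace_valZ (R : realType) (Z : normedModType R[i])
    (W : submodClosed Z) (a : R[i]) (f : subspace_of W) :
  subspace_val (a *: f) = a *: subspace_val f.
Proof. by []. Qed.

Lemma subspace_nrmE (R : realType) (Z : normedModType R[i])
    (W : submodClosed Z) (f : subspace_of W) : nrm (subspace_val f) = nrm f.
Proof. by []. Qed.

(** * Ranges of operators that are bounded below *)

Section range_of_operator.
Context {R : realType} {X Y : normedModType R[i]} (T : bop X Y).

Definition range_pred : {pred Y} := [pred y | `[< exists x, T x = y >]].

Lemma range_pred_submod_closed : submod_closed range_pred.
Proof.
split; first by rewrite inE; exists 0; rewrite linear0.
move=> a _ _ /asboolP[x <-] /asboolP[y <-]; rewrite inE.
by exists (a *: x + y); rewrite bop_linearP.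
Qed.

HB.instance Definition _ :=
  GRing.isSubmodClosed.Build _ _ range_pred range_pred_submod_closed.

Let range_proof x : T x \in range_pred.
Proof. by rewrite inE; exists x. Qed.

Definition corange (x : X) : subspace_of range_pred := SubspaceOf (range_proof x).

(** A choice of preimage; the default 0 is never taken on the range. It becomes linear in
    [banach_mazur_range], where injectivity of [T] makes preimages unique. *)
Definition preimage_of (y : subspace_of range_pred) : X :=
  xget 0 [set x | T x = subspace_val y].

Lemma preimage_ofK (y : subspace_of range_pred) : T (preimage_of y) = subspace_val y.
Proof.
rewrite /preimage_of; case: xgetP => [x _ /= ->//|noy].
by case: y noy => y /= /[dup] /asboolP[x xy] + /(_ x).
Qed.

End range_of_operator.

Lemma banach_mazur_range (R : realType) (X Y : normedModType R[i])
    (T : bop X Y) (c : R) : 0 < c -> (forall x, c * nrm x <= nrm (T x)) ->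
  (banach_mazur X (subspace_of (range_pred T)) <= (nrm T / c)%:E)%E.
Proof.
move=> c0 Tc.
have Tinj x y : T x = T y -> x = y.
  move=> xy; apply/eqP; rewrite -subr_eq0; apply/eqP/nrm_eq0/eqP.
  rewrite eq_le nrm_ge0 andbT -(pmulr_rle0 _ c0) (le_trans (Tc _))//.
  by rewrite linearB/= xy subrr nrm0.
have T'P : corange T \in bop_pred.
  apply: (@bop_predP _ _ _ _ (nrm T)) => [a x y|x].
    by apply: val_inj; exact: (bop_linearP T).
  exact: bop_le_nrm.
have S'P : @preimage_of R X Y T \in bop_pred.
  apply: (@bop_predP _ _ _ _ c^-1) => [a x y|x].
    by apply: Tinj; rewrite bop_linearP !preimage_ofK.
  by rewrite mulrC ler_pdivlMr// mulrC (le_trans (Tc _))// preimage_ofK.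
pose T' := Bop T'P; pose S' := Bop S'P.
have T'n : nrm T' <= nrm T.
  by apply: bop_nrm_le => x x1; exact: bop_ball_le.
have S'n : nrm S' <= c^-1.
  apply: bop_nrm_le => x x1; rewrite -[c^-1]mul1r ler_pdivlMr// mulrC.
  by rewrite (le_trans (Tc _))// preimage_ofK.
apply: le_trans (_ : ((nrm T' * nrm S')%:E <= _)%E); last first.
  by rewrite lee_fin ler_pM ?nrm_ge0.
apply: ereal_inf_lbound; exists T', S'; split=> // x.
  by apply: Tinj; rewrite preimage_ofK.
by apply: val_inj; exact: preimage_ofK.
Qed.

(** * Total boundedness *)

Section total_boundedness.
Context {R : realType} {V : normedModType R[i]}.
Implicit Types (A B : set V).

(** The centres of the net may lie outside [A], so that the property passes to subsets with the same
    net. *)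
Definition totally_bounded A := forall e : R, 0 < e ->
  exists s : seq V, forall x, A x -> exists2 y, y \in s & nrm (x - y) < e.

Lemma totally_boundedS A B : A `<=` B -> totally_bounded B -> totally_bounded A.
Proof. by move=> AB Btb e /Btb[s sB]; exists s => x /AB; exact: sB. Qed.

Lemma compact_totally_bounded A : compact A -> totally_bounded A.
Proof.
rewrite compact_cover => cA e e0.
have [||D _ AD] := cA V setT (fun y => [set x : V | nrm (x - y) < e]).
- move=> y _; rewrite openE => x /= xy; apply/nbhs_nrmP.
  exists (e - nrm (x - y)); first by rewrite subr_gt0.
  move=> z; rewrite ltrBrDr nrm_distC; apply: le_lt_trans.
  exact: nrm_triangle.
- by move=> x _; exists x => //=; rewrite subrr nrm0.
by exists (finmap.enum_fset D) => x /AD[y /= yD xy]; exists y.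
Qed.

Lemma totally_bounded_closure A : totally_bounded A -> totally_bounded (closure A).
Proof.
move=> Atb e e0; have [s sA] := Atb (e / 2) (divr_gt0 e0 (ltr0n _ 2)).
exists s => x /closure_nrmP/(_ (e / 2))[|y /sA[z zs yz] xy]; first by rewrite divr_gt0.
exists z => //; rewrite (le_lt_trans (nrm_triangle y _ _))// (splitr e).
exact: ltrD.
Qed.

Lemma totally_bounded_approx A : (forall e : R, 0 < e ->
    exists2 B, totally_bounded B & forall x, A x -> exists2 y, B y & nrm (x - y) < e) ->
  totally_bounded A.
Proof.
move=> AB e e0; have e20 : 0 < e / 2 by rewrite divr_gt0.
have [B Btb AB'] := AB _ e20; have [s sB] := Btb _ e20.
exists s => x /AB'[y /sB[z zs yz] xy]; exists z => //.
by rewrite (le_lt_trans (nrm_triangle y _ _))// (splitr e) ltrD.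
Qed.

Lemma totally_bounded_lincomb A B (a : R[i]) :
  totally_bounded A -> totally_bounded B ->
  totally_bounded [set z | exists x y, [/\ A x, B y & z = a *: x + y]].
Proof.
move=> Atb Btb e e0; have e20 : 0 < e / 2 by rewrite divr_gt0.
have a1 : 0 < nrm a + 1 by rewrite ltr_wpDl ?nrm_ge0.
have [s sA] := Atb (e / 2 / (nrm a + 1)) (divr_gt0 e20 a1).
have [t tB] := Btb _ e20; exists [seq a *: x + y | x <- s, y <- t].
move=> _ [x [y [/sA[x' x's xx'] /tB[y' y't yy'] ->]]].
exists (a *: x' + y'); first by apply/allpairsP; exists (x', y').
rewrite opprD addrACA -scalerBr (le_lt_trans (nrmD _ _))// (splitr e).
rewrite ler_ltD// nrmZ; move: xx'; rewrite ltr_pdivlMr// mulrC => /ltW.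
by apply: le_trans; rewrite ler_wpM2r ?nrm_ge0// lerDl.
Qed.

Lemma totally_bounded_scale A (c : R) : 0 < c ->
  totally_bounded A -> totally_bounded [set z | exists2 x, A x & z = c%:C *: x].
Proof.
move=> c0 Atb; apply: totally_boundedS
  (totally_bounded_lincomb c%:C Atb (_ : totally_bounded [set 0])).
  by move=> _ [x Ax ->]; exists x, 0; split => //; rewrite addr0.
by move=> e e0; exists [:: 0] => x ->; exists 0; rewrite ?inE// subrr nrm0.
Qed.

End total_boundedness.

(** Pigeonhole: the values of each functional lie in a disc covered by finitely many small discs,
    and points of [A] whose values share the same discs for all [n] functionals are close in
    norm. *)
Lemma totally_bounded_functionals (R : realType) (V : normedModType R[i])
    (A : set V) : (forall e : R, 0 < e -> exists (n : nat) (phi : nat -> V -> R[i]) (M : R),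
    (forall k x, A x -> nrm (phi k x) <= M) /\
    forall x y, A x -> A y -> (forall k, (k < n)%N -> nrm (phi k x - phi k y) < e) ->
      nrm (x - y) < e) ->
  totally_bounded A.
Proof.
move=> Aphi e e0; have [n [phi [M [phiM phie]]]] := Aphi e e0.
(* The representatives are kept inside [A], since the hypothesis only compares points of [A]. The
   induction is over the number of functionals, for all [A]. *)
suff [s sA] : exists s : seq V, forall x, A x -> exists2 y, y \in s &
    A y /\ forall k, (k < n)%N -> nrm (phi k x - phi k y) < e.
  by exists s => x /[dup] Ax /sA[y ys [Ay xy]]; exists y => //; exact: phie.
elim: n {phie} A {Aphi} phiM => [|n IH] A phiM.
  have [[x Ax]|A0] := pselect (A !=set0).
    by exists [:: x] => y Ay; exists x; rewrite ?inE.
  by exists [::] => x Ax; exfalso; apply: A0; exists x.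
have [t tM] := @compact_totally_bounded _ _ _ (@compact_closed_disc R M) _
  (divr_gt0 e0 (ltr0n _ 2)).
pose Az (z : R[i]) := [set x | A x /\ nrm (phi n x - z) < e / 2].
have /choice[s sP] (z : R[i]) : exists s : seq V, forall x, Az z x ->
    exists2 y, y \in s & Az z y /\ forall k, (k < n)%N -> nrm (phi k x - phi k y) < e.
  by apply: (IH (Az z)) => k x [Ax _]; exact: phiM.
exists (flatten [seq s z | z <- t]) => x Ax.
have [z zt xz] := tM (phi n x) (phiM n x Ax).
have [//|y ys [[Ay yz] xy]] := sP z x _.
exists y; first by apply/flatten_mapP; exists z.
split=> // k; rewrite ltnS leq_eqVlt => /orP[/eqP->|]; last exact: xy.
rewrite (le_lt_trans (nrm_triangle z _ _))// (splitr e) ltrD//.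
by rewrite nrm_distC.
Qed.

(** * The embedding into c_0 *)

Section disk_net.
Context {R : realType}.

Lemma half_exp_lt (e : R) : 0 < e ->
  exists N, forall n, (N <= n)%N -> 2^-1 ^+ n < e.
Proof.
move=> e0; exists (Num.truncn e^-1) => n Nn.
rewrite exprVn -[e]invrK ltf_pV2 ?posrE ?exprn_gt0 ?invr_gt0//.
apply: lt_le_trans (truncnS_gt _) _.
by rewrite -natrX ler_nat (leq_ltn_trans Nn)// ltn_expl.
Qed.

(* Two-parameter families (m, j), flattened by pickle; m indexes the distance
   to the boundary, and unused indices are sent to points tending to 1. *)
Lemma disk_net (eta : R) : 0 < eta -> exists p : nat -> disk R,
  (forall s, s < 1 -> exists N, forall n, (N <= n)%N -> s < nrm (p n : R[i])) /\
  (forall z : disk R, exists n,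
     nrm (disk_val (p n) - disk_val z) <= eta * (1 - nrm (z : R[i]))).
Proof.
wlog eta1 : eta / eta <= 1.
  move=> H eta0; have [||p [p1 pz]] := H (Num.min eta 1).
  - by rewrite ge_min lexx orbT.
  - by rewrite lt_min eta0 ltr01.
  exists p; split=> // z; have [n zn] := pz z; exists n.
  rewrite (le_trans zn)// ler_wpM2r ?ge_min ?lexx//.
  by rewrite subr_ge0 ltW// disk_valP.
move=> eta0.
(* The layer m consists of the z with 2^-(m+1) < 1 - |z| <= 2^-m, so a mesh of eta 2^-(m+1) is at
   most eta (1 - |z|) there. As eta <= 1, a net point this close to the layer lies in the open disk
   and has 1 - |d| <= 2 * 2^-m, which is the test [good]. *)
pose em m : R := eta * 2^-1 ^+ m.+1.
have em0 m : 0 < em m by rewrite mulr_gt0// exprn_gt0.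
have /choice[L Ltb] m := @compact_totally_bounded _ _ _
  (@compact_closed_disc R 1) _ (em0 m).
pose good m j (d : R[i]) := [/\ (j < size (L m))%N, nrm d < 1 &
  1 - nrm d <= 2 * 2^-1 ^+ m].
have /choice[p pP] n : exists d : disk R,
    (forall m j, n = pickle (m, j) -> good m j (L m)`_j -> disk_val d = (L m)`_j) /\
    ((exists m j, n = pickle (m, j) /\ good m j (d : R[i])) \/
     1 - nrm (d : R[i]) <= 2^-1 ^+ n).
  have [[m [j [nmj g]]]|nog] := pselect
      (exists m j, n = pickle (m, j) /\ good m j (L m)`_j).
    have [_ d1 _] := g; exists (Disk d1); split; last by left; exists m, j.
    move=> m' j'; rewrite nmj => mj' _.
    by have [<- <-] : (m, j) = (m', j') by exact: (pcan_inj pickleK).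
  have h0 : 0 < 2^-1 ^+ n :> R by rewrite exprn_gt0.
  have h1 : 2^-1 ^+ n <= 1 :> R by apply: exprn_ile1; rewrite ?invr_ge0 ?invf_le1 ?ler1n.
  have d1 : nrm ((1 - 2^-1 ^+ n)%:C : R[i]) < 1.
    by rewrite nrmR ger0_norm ?subr_ge0// ltrBlDr ltrDl.
  exists (Disk d1); split=> [m j nmj g|]; first by exfalso; apply: nog; exists m, j.
  by right; rewrite /= nrmR ger0_norm ?subr_ge0// subKr.
exists p; split=> [s s1|z].
  have s10 : 0 < (1 - s) / 2 by rewrite divr_gt0// subr_gt0.
  have [N0 hN0] := half_exp_lt s10.
  (* The sum of the codes of all pairs in the first [N0] layers exceeds or equals each of them, so a
     larger index can only code a pair with m >= N0. *)
  exists (maxn N0 (\sum_(m < N0) \sum_(j < size (L m)) pickle (val m, val j)).+1).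
  move=> n; rewrite geq_max => /andP[nN0 nB].
  have [_ [[m [j [nmj [jL _ dm]]]]|dn]] := pP n; last first.
    by have := hN0 n nN0; lra.
  have [mN0|/hN0] := ltnP m N0; last by lra.
  move: nB; rewrite ltnNge => /negP; case.
  rewrite (bigD1 (Ordinal mN0))//= (bigD1 (Ordinal jL))//= nmj.
  by rewrite -addnA leq_addr.
have z0 : 0 < 1 - nrm (z : R[i]) by rewrite subr_gt0 disk_valP.
have [m zm mmin] : exists2 m, 2^-1 ^+ m.+1 < 1 - nrm (z : R[i]) &
    1 - nrm (z : R[i]) <= 2^-1 ^+ m.
  have exm : exists m, 2^-1 ^+ m < 1 - nrm (z : R[i]).
    by have [N hN] := half_exp_lt z0; exists N; exact: hN.
  have := ex_minnP exm; case=> -[|m] zm mmin.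
    by move: zm; rewrite expr0 ltNge lerBlDr lerDl nrm_ge0.
  by exists m => //; rewrite leNgt; apply/negP => /mmin; rewrite ltnn.
have [y yL zy] := Ltb m (disk_val z) (ltW (disk_valP z)).
move/(nthP 0) : yL => [j jL jy].
have h0 : 0 < 2^-1 ^+ m.+1 :> R by rewrite exprn_gt0.
have yz : nrm (y - disk_val z) < eta * 2^-1 ^+ m.+1 by rewrite nrm_distC.
have g : good m j (L m)`_j.
  rewrite jy; split=> //.
    have := @nrm_dist_le R R[i] (disk_val z) y; nra.
  have := @nrm_dist_le R R[i] y (disk_val z); rewrite nrm_distC.
  move: mmin yz; rewrite exprS; nra.
exists (pickle (m, j)); have [/(_ m j erefl g) -> _] := pP (pickle (m, j)).
by rewrite jy (le_trans (ltW yz))// ler_wpM2l ?(ltW eta0)// ltW.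
Qed.

End disk_net.

Lemma c0_lincombE (R : realType) (a : R[i]) (f g : c0 R) n :
  (a *: f + g : c0 R) n = a *: f n + g n.
Proof. by []. Qed.

Section sampling.
Context {R : realType}.

(** Two errors add up to 20 eta: the change of f costs 16 eta by [bloch_lip], and the relative
    change of the weight costs 4 eta, because the weights differ by at most 2 |y - z| <= 2 eta (1 -
    |z|) while 1 - |z| is at most twice the weight at y. *)
Lemma bloch_sample (eta : R) (f : bloch R) (z y : disk R) :
  eta <= 2^-1 -> nrm (disk_val y - disk_val z) <= eta * (1 - nrm (z : R[i])) ->
  bloch_weight z * nrm (f z) <= bloch_weight y * nrm (f y) + 20 * eta * nrm f.
Proof.
move=> eta2; have t0 := disk_dist_gt0 z; set t := 1 - _ in t0 *.
have f0 := nrm_ge0 f; have fz0 := nrm_ge0 (f z); have fy0 := nrm_ge0 (f y).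
move=> yz; have eta0 : 0 <= eta.
  by rewrite -(pmulr_lge0 _ t0) (le_trans _ yz)// nrm_ge0.
have wz0 := bloch_weight_gt0 z; have wy0 := bloch_weight_gt0 y.
have yz2 : nrm (disk_val y - disk_val z) <= t / 2 by nra.
have := @bloch_lip R f z y yz2; rewrite -/t.
have : nrm (disk_val y - disk_val z) / t <= eta by rewrite ler_pdivrMr.
set q := _ / t => qeta L.
have fzy : bloch_weight z * nrm (f z) <=
    bloch_weight z * nrm (f y) + bloch_weight z * nrm (f y - f z).
  rewrite -mulrDr ler_wpM2l ?(ltW wz0)// nrm_distC; exact: nrm_dist_le.
have wzy : bloch_weight z <= bloch_weight y + 4 * eta * bloch_weight y.
  have := bloch_weight_ge y.
  have := @nrm_dist_le R R[i] (disk_val z) (disk_val y).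
  have := @nrm_dist_le R R[i] (disk_val y) (disk_val z); rewrite nrm_distC.
  have := disk_valP y; have := disk_valP z.
  have := @nrm_ge0 R R[i] (disk_val y); have := @nrm_ge0 R R[i] (disk_val z).
  move: wy0 yz; rewrite /bloch_weight /t.
  set a := nrm (disk_val z); set b := nrm (disk_val y); set d := nrm (_ - _).
  move=> wy0 yz a0 b0 a1 b1 abd bad wb.
  have h1 : 1 - a ^+ 2 - (1 - b ^+ 2) <= 2 * d by nra.
  have h2 : (1 - a) / 2 <= 1 - b ^+ 2 by nra.
  nra.
have wfy : bloch_weight y * nrm (f y) <= nrm f := bloch_le_nrm f y.
have : bloch_weight z * nrm (f y) <= bloch_weight y * nrm (f y) + 4 * eta * nrm f.
  apply: le_trans (_ : (bloch_weight y + 4 * eta * bloch_weight y) * nrm (f y) <= _).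
    by rewrite ler_wpM2r.
  by rewrite mulrDl lerD2l -mulrA ler_wpM2l// mulr_ge0.
have : 16 * q * nrm f <= 16 * eta * nrm f by rewrite ler_wpM2r// ler_wpM2l.
lra.
Qed.

Variable p : nat -> disk R.
Hypothesis p1 : forall s, s < 1 -> exists N, forall n, (N <= n)%N -> s < nrm (p n : R[i]).

Lemma little_bloch_vanishes (f : little_bloch R) : vanishes_at_boundary (subspace_val f).
Proof. by case: f => f /=; rewrite inE. Qed.

Definition sample (f : little_bloch R) : nat -> R[i]^o :=
  fun n => (bloch_weight (p n))%:C *: (subspace_val f (p n) : R[i]^o).

Lemma nrm_sample f n :
  nrm (sample f n) = bloch_weight (p n) * nrm (subspace_val f (p n)).
Proof. by rewrite nrmZ nrmR ger0_norm// ltW// bloch_weight_gt0. Qed.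

Lemma sample_c0 f : sample f \in c0_pred.
Proof.
rewrite inE; apply/cvg_seq_nrmP => e e0.
have [r r1 fr] := little_bloch_vanishes f e0; have [N pN] := p1 r1.
by exists N => n /pN/fr; rewrite sub0r nrmN nrm_sample.
Qed.

Lemma sample_nrm_le f : nrm (C0 (sample_c0 f)) <= nrm f.
Proof.
rewrite nrm_c0E; apply: ge_sup => [|_ [n _ <-]].
  by exists (nrm (sample f 0%N)), 0%N.
by rewrite [nrm _]nrm_sample; exact: bloch_le_nrm.
Qed.

Lemma sample_bop : (fun f => C0 (sample_c0 f)) \in @bop_pred R (little_bloch R) (c0 R).
Proof.
apply: (@bop_predP _ _ _ _ 1) => [a f g|f]; last by rewrite mul1r sample_nrm_le.
apply/val_inj/funext => n; rewrite [RHS]c0_lincombE /val /= /sample.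
rewrite subspace_lincombE bloch_lincombE.
by rewrite scalerDr scalerA mulrC -scalerA.
Qed.

Lemma sample_le_nrm f n : nrm (sample f n) <= nrm (C0 (sample_c0 f)).
Proof.
rewrite nrm_c0E; apply: ub_le_sup; last by exists n.
exists (nrm f) => _ [k _ <-].
by rewrite [nrm _]nrm_sample; exact: bloch_le_nrm.
Qed.

End sampling.

Lemma little_bloch_embeds_c0 (R : realType) :
  embeds_almost_isometrically (little_bloch R) (c0 R).
Proof.
(* The lower bound of the sampling map will be c = 1 - 20 eta. The first entry gives c >= 1/2, the
   second (1 + e) c >= 1 + e / 2 > 1. *)
move=> e e0; pose eta : R := Num.min (1 / 40) (e / (40 * (1 + e))).
have eta0 : 0 < eta by rewrite lt_min !divr_gt0// ?mulr_gt0// addr_gt0.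
have eta40 : eta <= 1 / 40 by rewrite ge_min lexx.
have etae : eta <= e / (40 * (1 + e)) by rewrite ge_min lexx orbT.
have [p [p1 pz]] := disk_net eta0.
pose T := Bop (sample_bop p1).
pose c := 1 - 20 * eta; have c_gt0 : 0 < c by rewrite /c; lra.
(* Taking the supremum over z in [bloch_sample] gives |f| <= |T f| + 20 eta |f|. *)
have Tc f : c * nrm f <= nrm (T f).
  rewrite /c mulrBl mul1r lerBlDr; apply: bloch_nrm_le => z.
  have [n zn] := pz z; rewrite (le_trans (bloch_sample (subspace_val f) _ zn))//.
    by lra.
  by rewrite lerD2r -nrm_sample sample_le_nrm.
pose W : submodClosed (c0 R) := range_pred T.
exists W; apply: le_lt_trans (banach_mazur_range c_gt0 Tc) _.
rewrite lte_fin ltr_pdivrMr//.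
have T1 : nrm T <= 1.
  by apply: bop_nrm_le => f f1; rewrite (le_trans (sample_nrm_le p1 f)).
apply: le_lt_trans T1 _; move: etae; rewrite ler_pdivlMr ?mulr_gt0 ?addr_gt0// /c.
nra.
Qed.

(** * Montel's theorem *)

Section ultrafilter_limits.
Context {R : realType}.

(** Compactness of the disc gives a cluster point, and a cluster point along an ultrafilter is a
    limit: otherwise the points far from it would form a member of [U]. *)
Lemma ultra_cvg (T : Type) (U : set_system T) (f : T -> R[i]^o) (M : R) :
  UltraFilter U -> (\forall t \near U, nrm (f t) <= M) ->
  exists l : R[i]^o, f @ U --> l.
Proof.
move=> UU fM; have UF : ProperFilter U by exact: ultra_proper.
have [|l [_ lU]] := @compact_closed_disc R M (f @ U) _ _; first exact: fM.
exists l; apply/cvg_nrmP => e e0.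
have [//|UC] := in_ultra_setVsetC [set t | nrm (l - f t) < e] UU.
have UC' : U (f @^-1` (f @` (~` [set t | nrm (l - f t) < e]))).
  by apply: filterS UC => t tC; exists t.
have le_nbhs : nbhs l [set y | nrm (l - y) < e] by apply/nbhs_nrmP; exists e.
have [_ [[t tC <-] le]] := lU _ _ UC' le_nbhs.
by exfalso; exact: tC.
Qed.

Lemma ultra_seq_cover (T : Type) (I : eqType) (U : set_system T) (s : seq I)
    (P : I -> set T) :
  UltraFilter U -> U [set t | exists2 i, i \in s & P i t] ->
  exists2 i, i \in s & U (P i).
Proof.
move=> UU; have UF : ProperFilter U by exact: ultra_proper.
elim: s => [|i s IH] Us.
  by have [t [j]] := filter_ex Us; rewrite in_nil.
have [UP|UP] := in_ultra_setVsetC (P i) UU; first by exists i; rewrite ?mem_head.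
have [|j j_s UPj] := IH; last by exists j; rewrite // inE j_s orbT.
apply: filterS (filterI UP Us) => t [nPi [j]]; rewrite inE => /predU1P[-> //|j_s Pj].
by exists j.
Qed.

Lemma cvg_partial_sum (T : Type) (U : set_system T) {UF : Filter U}
    (a : T -> nat -> R[i]) (A : nat -> R[i]) (h : R[i]) n :
  (forall k, (fun t => a t k : R[i]^o) @ U --> (A k : R[i]^o)) ->
  (fun t => \sum_(k < n) a t k * h ^+ k : R[i]^o) @ U -->
    (\sum_(k < n) A k * h ^+ k : R[i]^o).
Proof.
move=> aA; elim: n => [|n IH].
  rewrite big_ord0 (_ : (fun=> _) = cst 0); first exact: cvg_cst.
  by apply/funext => t; rewrite big_ord0.
have E (b : nat -> R[i]) : \sum_(k < n.+1) b k * h ^+ k =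
    h ^+ n *: (b n : R[i]^o) + (\sum_(k < n) b k * h ^+ k : R[i]^o).
  by rewrite big_ord_recr/= addrC mulrC.
rewrite E (_ : (fun t => _) = (fun t =>
    h ^+ n *: (a t n : R[i]^o) + (\sum_(k < n) a t k * h ^+ k : R[i]^o))).
  exact: (@cvg_lincomb R[i] R[i]^o T U _ (h ^+ n) _ _ _ _ (aA n) IH).
by apply/funext => t; exact: E.
Qed.

(** The values and the Taylor coefficients are bounded along [U], so both converge. The remainder
    bound of [bloch_taylor] is uniform in the family and survives the limit, which makes the limit
    coefficients a power series of the limit function. *)
Lemma bloch_montel (T : Type) (U : set_system T) (F : T -> bloch R) (M : R) :
  UltraFilter U -> (\forall t \near U, nrm (F t) <= M) ->
  exists g : bloch R, forall z, (fun t => F t z) @ U --> g z.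
Proof.
move=> UU FM; have UF : ProperFilter U by exact: ultra_proper.
have w0 z := @bloch_weight_gt0 R z.
have /choice[g gl] z : exists l : R[i]^o, (fun t => F t z) @ U --> l.
  apply: (@ultra_cvg _ _ _ (M / bloch_weight z)) => //.
  apply: filterS FM => t tM; rewrite ler_pdivlMr// mulrC.
  exact: le_trans (bloch_le_nrm _ _) tM.
suff gP : g \in bloch_pred by exists (Bloch gP).
rewrite inE; split; last first.
  exists M => z; rewrite mulrC -ler_pdivlMr//; apply: nrm_cvg_le (gl z) _.
  apply: filterS FM => t tM; rewrite ler_pdivlMr// mulrC.
  exact: le_trans (bloch_le_nrm _ _) tM.
move=> z; pose s := (1 - nrm (z : R[i])) / 2.
have s0 : 0 < s by rewrite divr_gt0// disk_dist_gt0.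
have /choice[a Fa] t := bloch_taylor (F t) z; rewrite -/s in Fa.
have M0 : 0 <= M by have [t /(le_trans (nrm_ge0 _))] := filter_ex FM.
have /choice[A aA] n : exists l : R[i]^o, (fun t => a t n : R[i]^o) @ U --> l.
  apply: (@ultra_cvg _ _ _ (M / s * 2 ^+ n / s ^+ n)) => //.
  apply: filterS FM => t tM; rewrite ler_pdivlMr ?exprn_gt0//.
  have [/le_trans + _] := Fa t n; apply.
  by rewrite ler_wpM2r ?exprn_ge0// ler_wpM2r ?invr_ge0 ?(ltW s0).
have gA n (y : disk R) : nrm (disk_val y - disk_val z) <= s ->
    nrm (g y - \sum_(k < n) A k * (disk_val y - disk_val z) ^+ k : R[i]) <=
      M / s * (2 * (nrm (disk_val y - disk_val z) / s)) ^+ n.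
  move=> ys; apply: (@nrm_cvg_le R R[i]^o _ U _ (fun t => F t y -
      (\sum_(k < n) a t k * (disk_val y - disk_val z) ^+ k : R[i]^o))).
    by apply: cvgB; [exact: gl|exact: cvg_partial_sum].
  apply: filterS FM => t tM; have [_ /(_ y ys)/le_trans] := Fa t n; apply.
  rewrite ler_wpM2r ?exprn_ge0 ?mulr_ge0 ?invr_ge0 ?nrm_ge0 ?(ltW s0)//.
  by rewrite ler_wpM2r ?invr_ge0 ?(ltW s0).
(* Within s / 4 the ratio 2 |h| / s is at most 1/2, so the remainders tend to 0. *)
exists (s / 4), A; split; first by rewrite divr_gt0.
move=> y ys; apply/cvg_seq_nrmP => e e0.
have C0 : 0 < M / s + 1 by rewrite ltr_wpDl// divr_ge0// ltW.
have [N hN] := half_exp_lt (divr_gt0 e0 C0); exists N => n /hN.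
rewrite ltr_pdivlMr// => ne; rewrite pseries_partialE.
apply: le_lt_trans (gA n y _) _; first by move: ys s0; lra.
apply: le_lt_trans ne; rewrite mulrC ler_pM ?exprn_ge0 ?lerDl//.
- by rewrite mulr_ge0// divr_ge0 ?nrm_ge0// ltW.
- by rewrite divr_ge0// ltW.
rewrite lerXn2r ?nnegrE ?mulr_ge0 ?invr_ge0 ?nrm_ge0 ?(ltW s0)//.
rewrite mulrA ler_pdivrMr//; move: ys; set d := nrm _; move=> ys.
by rewrite -(ler_pM2l (ltr0n R 2)); lra.
Qed.

(** An ultrafilter on a totally bounded set is Cauchy for the norm. [bloch_montel] supplies a
    pointwise limit, the Cauchy property makes the convergence uniform in the weighted norm, and the
    limit inherits the decay at the boundary. *)
Lemma little_bloch_compact (A : set (little_bloch R)) :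
  totally_bounded A -> compact (closure A).
Proof.
move=> /totally_bounded_closure; set B := closure A => Btb.
rewrite compact_ultra => U UU UB; have UF : ProperFilter U by exact: ultra_proper.
have Ucauchy (e : R) : 0 < e -> exists y, U [set x | nrm (x - y) < e].
  move=> e0; have [s sB] := Btb _ e0.
  have [|y _ Uy] := @ultra_seq_cover _ _ U s (fun y => [set x | nrm (x - y) < e]) UU.
    by apply: filterS UB => x /sB.
  by exists y.
have [y1 Uy1] := Ucauchy 1 ltr01.
have [g gl] : exists g : bloch R, forall z,
    (fun x : little_bloch R => subspace_val x z) @ U --> g z.
  apply: (@bloch_montel _ U (@subspace_val _ _ _) (nrm y1 + 1)) => //.
  apply: filterS Uy1 => x xy1.
  by rewrite (le_trans (nrm_dist_le y1 x))// lerD2l ltW.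
have ug (e : R) : 0 < e -> U [set x | nrm (subspace_val x - g) <= e].
  move=> e0; have [y Uy] := Ucauchy (e / 2) (divr_gt0 e0 (ltr0n _ 2)).
  apply: filterS (Uy) => x xy; apply: bloch_nrm_le => z.
  rewrite mulrC -ler_pdivlMr ?bloch_weight_gt0//.
  (* With x fixed, the other point t runs along [U] to the pointwise limit g in the Cauchy estimate
     for x - t. *)
  apply: (@nrm_cvg_le R R[i]^o _ U _ (fun t => subspace_val x z - subspace_val t z)).
    by apply: cvgB; [exact: cvg_cst|exact: gl].
  apply: filterS Uy => t ty; rewrite ler_pdivlMr ?bloch_weight_gt0// mulrC.
  apply: (le_trans (bloch_le_nrm (subspace_val x - subspace_val t) z)).
  rewrite -subspace_valB subspace_nrmE.
  apply: le_trans (nrm_triangle y _ _) _; rewrite (splitr e).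
  by apply: lerD; [exact: ltW xy|rewrite nrm_distC; exact: ltW ty].
have gP : g \in little_bloch_pred R.
  rewrite inE => e e0; have e20 : 0 < e / 2 by rewrite divr_gt0.
  have [x xg] := filter_ex (ug _ e20).
  have [r r1 xr] := little_bloch_vanishes x e20; exists r => // z /xr xz.
  apply: (@le_lt_trans _ _ (bloch_weight z *
      (nrm (subspace_val x z) + nrm (g z - subspace_val x z)))).
    by rewrite ler_wpM2l ?nrm_dist_le// ltW// bloch_weight_gt0.
  rewrite mulrDr (splitr e) ltr_leD// nrm_distC.
  exact: le_trans (bloch_le_nrm (subspace_val x - g) z) xg.
exists (SubspaceOf gP); have UG : U --> (SubspaceOf gP : little_bloch R).
  move=> V /nbhs_nrmP[e e0 eV].
  apply: filterS (ug _ (divr_gt0 e0 (ltr0n _ 2))) => x xg; apply: eV.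
  apply: (@le_lt_trans _ _ (e / 2)); last by rewrite ltr_pdivrMr// ltr_pMr// ltr1n.
  by rewrite nrm_distC.
split=> //; apply: closed_closure => V /UG UV.
by have [x [Bx Vx]] := filter_ex (filterI UB UV); exists x.
Qed.

End ultrafilter_limits.

(** * Averages of dilations *)

Section dilation.
Context {R : realType} (r : R) (r01 : 0 <= r < 1).

Let r0 : 0 <= r. Proof. by case/andP: r01. Qed.
Let r1 : r < 1. Proof. by case/andP: r01. Qed.

Lemma dilate_proof (z : disk R) : nrm (r%:C * disk_val z) < 1.
Proof.
rewrite nrmM nrmR ger0_norm// (le_lt_trans _ (disk_valP z))//.
by rewrite ler_piMl ?nrm_ge0// ltW.
Qed.

Definition dilate (z : disk R) : disk R := Disk (dilate_proof z).

Lemma nrm_dilate z : nrm (disk_val (dilate z)) = r * nrm (disk_val z).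
Proof. by rewrite /= nrmM nrmR ger0_norm. Qed.

Lemma dilate_dist z :
  nrm (disk_val (dilate z) - disk_val z) = (1 - r) * nrm (disk_val z).
Proof.
rewrite /= -[X in _ - X]mul1r -mulrBl nrmM -[1]/(1%:C) -rmorphB /= nrmR.
by rewrite distrC ger0_norm// subr_ge0 ltW.
Qed.

Lemma bloch_weight_dilate z : bloch_weight z <= bloch_weight (dilate z).
Proof.
rewrite /bloch_weight nrm_dilate exprMn lerD2l lerN2 ler_piMl ?sqr_ge0//.
by rewrite expr_le1// ltW.
Qed.

Lemma bloch_weight_dilate_ge z : 1 - r <= bloch_weight (dilate z).
Proof.
apply: le_trans (bloch_weight_ge _); rewrite nrm_dilate lerD2l lerN2.
by rewrite ler_piMr// ltW// disk_valP.
Qed.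

Lemma dilate_analytic (f : bloch R) : analytic_on_disk (f \o dilate).
Proof.
move=> z; have [s [a [s0 fa]]] := bloch_analytic f (dilate z).
exists s, (fun k => a k * r%:C ^+ k); split; first exact: s0.
move=> y yz; have E : disk_val (dilate y) - disk_val (dilate z) =
    r%:C * (disk_val y - disk_val z) by rewrite /= mulrBr.
have := fa (dilate y); rewrite E => /(_ _).
rewrite (_ : pseries_partial (fun k => a k * r%:C ^+ k) _ =
    pseries_partial a (r%:C * (disk_val y - disk_val z))).
  apply; rewrite nrmM nrmR ger0_norm// (le_lt_trans _ yz)//.
  by rewrite ler_piMl ?nrm_ge0// ltW.
apply/funext => n; apply: etrans (pseries_partialE _ _ _) _.
apply/esym; apply: etrans (pseries_partialE _ _ _) _.
by apply: eq_bigr => k _; rewrite exprMn mulrA.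
Qed.

Lemma dilate_le (f : bloch R) z : bloch_weight z * nrm (f (dilate z)) <= nrm f.
Proof.
apply: le_trans (bloch_le_nrm f (dilate z)).
by rewrite ler_wpM2r ?nrm_ge0// bloch_weight_dilate.
Qed.

(** The dilated function is bounded by |f| / (1 - r) on the whole disk, so the weight alone forces
    decay, at a rate uniform on the unit ball. *)
Lemma dilate_le_boundary (f : bloch R) z :
  bloch_weight z * nrm (f (dilate z)) <=
    2 * (1 - nrm (disk_val z)) / (1 - r) * nrm f.
Proof.
have r10 : 0 < 1 - r by rewrite subr_gt0.
apply: (@le_trans _ _ (2 * (1 - nrm (disk_val z)) * nrm (f (dilate z)))).
  by rewrite ler_wpM2r ?nrm_ge0// bloch_weight_le.
rewrite -[leRHS]mulrA ler_wpM2l ?mulr_ge0 ?(ltW (disk_dist_gt0 z))//.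
rewrite mulrC ler_pdivlMr// mulrC; apply: le_trans (bloch_le_nrm f (dilate z)).
by rewrite ler_wpM2r ?nrm_ge0// bloch_weight_dilate_ge.
Qed.

Lemma dilate_bloch (f : bloch R) : f \o dilate \in bloch_pred.
Proof.
rewrite inE; split; first exact: dilate_analytic.
by exists (nrm f) => z; exact: dilate_le.
Qed.

Lemma dilate_little_bloch (f : bloch R) :
  Bloch (dilate_bloch f) \in little_bloch_pred R.
Proof.
rewrite inE => e e0; have r10 : 0 < 1 - r by rewrite subr_gt0.
pose c := e * (1 - r) / (2 * (nrm f + 1)).
have f1 : 0 < nrm f + 1 by rewrite ltr_wpDl ?nrm_ge0.
have c0 : 0 < c by rewrite divr_gt0 ?mulr_gt0.
exists (1 - c); first by rewrite ltrBlDr ltrDl.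
move=> z cz; apply: le_lt_trans (dilate_le_boundary f z) _.
have t0 := disk_dist_gt0 z; set t := 1 - nrm (disk_val z) in t0 *.
have tc : t < c by move: cz; rewrite /t; lra.
rewrite mulrAC ltr_pdivrMr//.
move: tc; rewrite /c ltr_pdivlMr ?mulr_gt0//.
have := nrm_ge0 f; nra.
Qed.

Definition dilation (f : bloch R) : little_bloch R :=
  SubspaceOf (dilate_little_bloch f).

Lemma dilationE f z : subspace_val (dilation f) z = f (dilate z).
Proof. by []. Qed.

Lemma dilation_nrm_le f : nrm (dilation f) <= nrm f.
Proof.
rewrite -subspace_nrmE; apply: bloch_nrm_le => z; rewrite dilationE.
exact: dilate_le.
Qed.

Lemma dilation_bop : dilation \in @bop_pred R (bloch R) (little_bloch R).
Proof.
apply: (@bop_predP _ _ _ _ 1) => [a f g|f]; last by rewrite mul1r dilation_nrm_le.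
by apply/val_inj/val_inj/funext.
Qed.

(** The samples over a fine net determine the norm up to a factor 2, and by the uniform decay at the
    boundary all but finitely many of them are negligible on the unit ball. The remaining ones serve
    as functionals. *)
Lemma dilation_totally_bounded :
  totally_bounded (dilation @` [set f : bloch R | nrm f <= 1]).
Proof.
have eta0 : 0 < 1 / 40 :> R by rewrite divr_gt0.
have [p [p1 pz]] := disk_net eta0.
have r10 : 0 < 1 - r by rewrite subr_gt0.
apply: totally_bounded_functionals => e e0.
(* Beyond this radius the decay bound for f - g, of norm at most 2, is below e / 4. The factor 4 on
   the functionals gives e / 4 for the other samples, and 20 / 40 = 1/2 then yields |h| <= e / 4 +
   |h| / 2. *)
have c1 : 1 - e * (1 - r) / 16 < 1.
  by rewrite ltrBlDr ltrDl divr_gt0// mulr_gt0.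
have [N pN] := p1 _ c1.
exists N, (fun k x => 4%:C * sample p x k : R[i]), 4; split.
  move=> k _ [f /= f1 <-]; rewrite nrmM nrmR ger0_norm// ger_pMr// (le_trans _ f1)//.
  rewrite (le_trans _ (dilation_nrm_le f))//.
  by rewrite (nrm_sample p) -subspace_nrmE bloch_le_nrm.
move=> _ _ [f /= f1 <-] [g /= g1 <-] fg.
pose h := subspace_val (dilation f - dilation g).
have hn n : bloch_weight (p n) * nrm (h (p n)) <= e / 4.
  have [nN|nN] := ltnP n N.
    have := fg n nN; rewrite -mulrBr nrmM nrmR ger0_norm//.
    rewrite -(ltr_pdivlMl _ _ (ltr0n R 4)) mulrC => /ltW; apply: le_trans.
    have -> : sample p (dilation f) n - sample p (dilation g) n =
        sample p (dilation f - dilation g) n.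
      by rewrite /sample subspace_valB -scalerBr.
    by rewrite -(nrm_sample p (dilation f - dilation g)).
  have -> : h (p n) = (f - g) (dilate (p n)) by [].
  apply: le_trans (dilate_le_boundary _ _) _.
  have := pN n nN; have := disk_dist_gt0 (p n).
  set t := 1 - _ => t0 tn; have te : t < e * (1 - r) / 16 by move: tn; rewrite /t; lra.
  have := nrmB f g; move: (nrm_ge0 (f - g)); set d := nrm (f - g) => d0 dle.
  have d2 : d <= 2 by rewrite (le_trans dle)//; lra.
  rewrite mulrAC ler_pdivrMr//; nra.
rewrite -subspace_nrmE -/h.
have : nrm h <= e / 4 + 20 * (1 / 40) * nrm h.
  apply: bloch_nrm_le => z; have [n zn] := pz z.
  apply: le_trans (bloch_sample h _ zn) _; first by lra.
  by rewrite lerD2r.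
lra.
Qed.

End dilation.

Section compact_operators_closure.
Context {R : realType} {X Y : normedModType R[i]}.
Implicit Types T S : bop X Y.

Definition tb_operator T := totally_bounded (T @` [set x : X | nrm x <= 1]).

Lemma tb_operator0 : tb_operator 0.
Proof.
move=> e e0; exists [:: 0] => _ [x _ <-]; exists 0; first by rewrite inE.
by rewrite subrr nrm0.
Qed.

Lemma tb_operator_lincomb a T S :
  tb_operator T -> tb_operator S -> tb_operator (a *: T + S).
Proof.
move=> Ttb Stb; apply: totally_boundedS (totally_bounded_lincomb a Ttb Stb).
by move=> _ [x x1 <-]; exists (T x), (S x); split; [exists x|exists x|].
Qed.

Lemma tb_operator_sum n (T : 'I_n -> bop X Y) :
  (forall k, tb_operator (T k)) -> tb_operator (\sum_(k < n) T k).
Proof.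
move=> Ttb; elim/big_rec : _ => [|k S _ Stb]; first exact: tb_operator0.
by rewrite -[T k]scale1r; exact: tb_operator_lincomb.
Qed.

Lemma tb_operator_closed T : (forall e : R, 0 < e ->
  exists2 S : bop X Y, tb_operator S & nrm (T - S) < e) -> tb_operator T.
Proof.
move=> TS; apply: totally_bounded_approx => e /TS[S Stb TSe].
exists (S @` [set x : X | nrm x <= 1]) => // _ [x x1 <-].
exists (S x); first by exists x.
by apply: le_lt_trans TSe; exact: (bop_ball_le (T - S) x1).
Qed.

End compact_operators_closure.

Section averages.
Context {R : realType}.

Lemma ratio_proof k : 0 <= (1 - 2^-1 ^+ k.+1 : R) < 1.
Proof.
have h0 : 0 < 2^-1 ^+ k.+1 :> R by rewrite exprn_gt0.
have h1 : 2^-1 ^+ k.+1 <= 1 :> R.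
  by apply: exprn_ile1; rewrite ?invr_ge0 ?invf_le1 ?ler1n.
by rewrite subr_ge0 h1 ltrBlDr ltrDl.
Qed.

Definition dil k : bop (bloch R) (little_bloch R) := Bop (dilation_bop (ratio_proof k)).

(** The radii are 1 - 2^-(k+1) for k from n + 1 to 2 n + 1. The block moves with n so that every
    term, and not only most of them, is close to the identity on a given f in beta_0 for large n. *)
Definition avg n : bop (bloch R) (little_bloch R) :=
  (n.+1%:R^-1)%:C *: \sum_(k < n.+1) dil (n.+1 + k).

Lemma tb_avg n : tb_operator (avg n).
Proof.
rewrite -[avg n]addr0; apply: tb_operator_lincomb; last exact: tb_operator0.
by apply: tb_operator_sum => k; exact: dilation_totally_bounded.
Qed.

Lemma bop_sumE (X Y : normedModType R[i]) n (T : 'I_n -> bop X Y) x :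
  (\sum_(k < n) T k) x = \sum_(k < n) T k x.
Proof. by elim/big_rec2 : _ => // k y S _ <-. Qed.

Lemma avg_lb n f : avg n f = (n.+1%:R^-1)%:C *: \sum_(k < n.+1) dil (n.+1 + k) f.
Proof. by rewrite -bop_sumE. Qed.

Lemma little_bloch_sumE n (F : 'I_n -> little_bloch R) z :
  subspace_val (\sum_(k < n) F k) z = \sum_(k < n) subspace_val (F k) z :> R[i].
Proof. by elim/big_rec2 : _ => // k y S _ <-. Qed.

Lemma avgE n f z : subspace_val (avg n f) z =
  (n.+1%:R^-1)%:C * \sum_(k < n.+1) f (dilate (ratio_proof (n.+1 + k)) z) :> R[i].
Proof.
by rewrite avg_lb subspace_valZ bloch_valZ little_bloch_sumE.
Qed.

Lemma avg_nrm_le n f : nrm (avg n f) <= nrm f.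
Proof.
rewrite avg_lb nrmZ nrmR ger0_norm ?invr_ge0// mulrC ler_pdivrMr//.
rewrite (le_trans (nrm_sum _ _ _))//.
apply: (@le_trans _ _ (\sum_(k < n.+1) nrm f)).
  by apply: ler_sum => k _; exact: dilation_nrm_le.
by rewrite sumr_const card_ord mulr_natr.
Qed.

Lemma dil_cvg (f : little_bloch R) (e : R) : 0 < e ->
  exists N, forall k, (N <= k)%N -> nrm (dil k (subspace_val f) - f) <= e.
Proof.
move=> e0; have e20 : 0 < e / 2 by rewrite divr_gt0.
have [r0 r01 fr] := little_bloch_vanishes f e20.
(* Half of the margin: if 1 - |z| < tau, a dilation that moves z by less than tau / 2 stays beyond
   r0, so f is small at both points. Otherwise [bloch_lip] applies with 1 - |z| >= tau. *)
pose tau := (1 - r0) / 2; have tau0 : 0 < tau by rewrite divr_gt0// subr_gt0.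
have f0 := nrm_ge0 f; have c0 : 0 < 16 * nrm f + 1 by rewrite ltr_wpDl ?mulr_ge0.
have [N hN] : exists N, forall k, (N <= k)%N ->
    2^-1 ^+ k.+1 < Num.min (tau / 2) (e * tau / (16 * nrm f + 1)).
  have [|N hN] := @half_exp_lt R (Num.min (tau / 2) (e * tau / (16 * nrm f + 1))).
    rewrite lt_min; apply/andP; split; first exact: divr_gt0.
    by apply: divr_gt0 => //; exact: mulr_gt0.
  by exists N => k Nk; apply: hN; exact: leqW.
exists N => k /hN; rewrite lt_min => /andP[d1 d2].
rewrite -subspace_nrmE; apply: bloch_nrm_le => z.
have -> : subspace_val (dil k (subspace_val f) - f) z =
    subspace_val f (dilate (ratio_proof k) z) - subspace_val f z by [].
have h0 : 0 < 2^-1 ^+ k.+1 :> R by rewrite exprn_gt0.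
have t0 := disk_dist_gt0 z; have w0 := bloch_weight_gt0 z.
have z0 := nrm_ge0 (disk_val z).
have dz := dilate_dist (ratio_proof k) z; rewrite subKr in dz.
have dzle : nrm (disk_val (dilate (ratio_proof k) z) - disk_val z) <= 2^-1 ^+ k.+1.
  by rewrite dz ler_piMr ?(ltW h0)// ltW// disk_valP.
have [tz|tz] := ltP (1 - nrm (disk_val z)) tau.
  apply: (@le_trans _ _ (bloch_weight z * (nrm (subspace_val f (dilate (ratio_proof k) z))
      + nrm (subspace_val f z)))).
    by rewrite ler_wpM2l ?(ltW w0)// nrmB.
  rewrite mulrDr (splitr e) lerD//; last first.
    by apply/ltW/fr; move: tz; rewrite /tau; lra.
  apply: le_trans (ltW (fr (dilate (ratio_proof k) z) _)).
    by rewrite ler_wpM2r ?nrm_ge0// bloch_weight_dilate.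
  have := nrm_dist_le (disk_val (dilate (ratio_proof k) z)) (disk_val z).
  rewrite nrm_distC; move: tz d1 dzle; rewrite /tau; lra.
apply: le_trans (bloch_lip (subspace_val f) (y := dilate (ratio_proof k) z) (z := z) _) _.
  by apply: le_trans dzle _; move: d1 tz; lra.
rewrite subspace_nrmE.
apply: (@le_trans _ _ (16 * (2^-1 ^+ k.+1 / tau) * nrm f)).
  rewrite ler_wpM2r// ler_wpM2l// ler_pM ?nrm_ge0 ?invr_ge0 ?(ltW t0)//.
  by rewrite lef_pV2.
rewrite mulrA mulrAC ler_pdivrMr//.
by move: d2; rewrite ltr_pdivlMr//; nra.
Qed.

Lemma avg_cvg (f : little_bloch R) (e : R) : 0 < e ->
  exists N, forall n, (N <= n)%N -> nrm (avg n (subspace_val f) - f) <= e.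
Proof.
move=> /(dil_cvg f)[N fN]; exists N => n Nn.
have -> : avg n (subspace_val f) - f = (n.+1%:R^-1)%:C *:
    \sum_(k < n.+1) (dil (n.+1 + k) (subspace_val f) - f).
  rewrite sumrB scalerBr -avg_lb sumr_const card_ord.
  rewrite -[X in _ *: X]scaler_nat scalerA.
  rewrite -(rmorph_nat (real_complex R)) -rmorphM /= mulVf ?pnatr_eq0//.
  by rewrite (rmorph1 (real_complex R)) scale1r.
rewrite nrmZ nrmR ger0_norm ?invr_ge0// mulrC ler_pdivrMr//.
rewrite (le_trans (nrm_sum _ _ _))//.
apply: (@le_trans _ _ (\sum_(k < n.+1) e)).
  by apply: ler_sum => k _; apply: fN; rewrite (leq_trans Nn)// addSn leqW// leq_addr.
by rewrite sumr_const card_ord mulr_natr.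
Qed.

(** Contractions that converge pointwise to the identity do so uniformly on totally bounded sets. *)
Lemma avg_cvg_operator (X : normedModType R[i]) (S : bop X (little_bloch R)) (e : R) :
  tb_operator S -> 0 < e -> exists N, forall n, (N <= n)%N ->
    forall x, nrm x <= 1 -> nrm (avg n (subspace_val (S x)) - S x) <= e.
Proof.
move=> Stb e0; have e30 : 0 < e / 3 by rewrite divr_gt0.
have [s sS] := Stb _ e30.
have [N sN] : exists N, forall y, y \in s -> forall n, (N <= n)%N ->
    nrm (avg n (subspace_val y) - y) <= e / 3.
  elim: s {sS} => [|y s [N sN]]; first by exists 0%N.
  have [M yM] := avg_cvg y e30; exists (maxn M N) => y'.
  rewrite inE => /predU1P[->|/sN ys] n; rewrite geq_max => /andP[Mn Nn].
    exact: yM.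
  exact: ys.
exists N => n Nn x x1; have [|y ys Sxy] := sS (S x); first by exists x.
have -> : avg n (subspace_val (S x)) - S x =
    (avg n (subspace_val (S x - y)) + (avg n (subspace_val y) - y)) + (y - S x).
  by rewrite subspace_valB linearB/= !addrA subrK subrK.
apply: le_trans (nrmD _ _) _; rewrite nrm_distC.
apply: (@le_trans _ _ (e / 3 + e / 3 + e / 3)); last by lra.
apply: lerD; last exact: ltW Sxy.
apply: le_trans (nrmD _ _) _; apply: lerD; last exact: sN.
by apply: le_trans (avg_nrm_le _ _) _; rewrite subspace_nrmE; exact: ltW Sxy.
Qed.

End averages.

(** * The averages as approximate multipliers by lam(z) in [0, 1] *)

Section averages_M.
Context {R : realType}.

(* With x = 1 - r_k and t = 1 - |z|, dilation by r_k is close to the identity at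
   z if x <= t / 2 and close to 0 otherwise; either error is at most
   36 x t / (x + t)^2, which the increments of x / (x + t) dominate. *)
Lemma dilate_selector k (z : disk R) (t := 1 - nrm (disk_val z))
    (phi := fun x : R => x / (x + t)) : exists b : bool, forall f : bloch R,
  bloch_weight z * nrm (f (dilate (ratio_proof k) z) - b%:R%:C * f z : R[i]) <=
    72 * (phi (2^-1 ^+ k) - phi (2^-1 ^+ k.+1)) * nrm f.
Proof.
have t0 : 0 < t := disk_dist_gt0 z.
have -> : 2^-1 ^+ k = 2 * 2^-1 ^+ k.+1 :> R by rewrite exprS mulrA mulfV// mul1r.
have x0 : 0 < 2^-1 ^+ k.+1 :> R by rewrite exprn_gt0.
have dz := dilate_dist (ratio_proof k) z; rewrite subKr in dz.
have bnd := fun f => dilate_le_boundary (ratio_proof k) f z; rewrite subKr in bnd.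
set x := 2^-1 ^+ k.+1 in x0 dz bnd *.
have xt0 : 0 < x + t by rewrite addr_gt0.
have xt20 : 0 < 2 * x + t by rewrite addr_gt0// mulr_gt0.
have phiE : phi (2 * x) - phi x = x * t / ((2 * x + t) * (x + t)).
  by rewrite /phi; field; rewrite !gt_eqF.
(* Since 2 x + t <= 2 (x + t); this factor turns 36 into the 72 of the statement. *)
have phi_ge : x * t / ((x + t) * (x + t)) <= 2 * (phi (2 * x) - phi x).
  rewrite phiE mulrA ler_pdivrMr ?mulr_gt0// mulrAC ler_pdivlMr ?mulr_gt0//.
  have p0 : 0 <= x * t * (x + t) by rewrite !mulr_ge0// ltW.
  nra.
have [xt|tx] := leP x (t / 2).
  exists true => f; rewrite mul1r.
  have dzx : nrm (disk_val (dilate (ratio_proof k) z) - disk_val z) <= x.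
    by rewrite dz ler_piMr ?(ltW x0)// ltW// disk_valP.
  apply: le_trans (bloch_lip f (le_trans dzx xt)) _.
  rewrite ler_wpM2r ?nrm_ge0//; apply: (@le_trans _ _ (16 * (x / t))).
    by rewrite ler_wpM2l// ler_wpM2r// invr_ge0 ltW.
  (* Here x + t <= 3 t / 2, and 36 = 16 * 9 / 4. In the other case x + t <= 3 x, which would even
     allow 18. *)
  apply: (@le_trans _ _ (36 * (x * t / ((x + t) * (x + t))))); last by lra.
  rewrite mulrA ler_pdivrMr// mulrAC mulrA ler_pdivlMr ?mulr_gt0//.
  have : (x + t) * (x + t) <= 9 / 4 * (t * t) by nra.
  move=> h; have := ler_wpM2l (ltW x0) h; nra.
exists false => f; rewrite mul0r subr0; apply: le_trans (bnd f) _.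
rewrite ler_wpM2r ?nrm_ge0//.
apply: (@le_trans _ _ (36 * (x * t / ((x + t) * (x + t))))); last by lra.
rewrite -/t ler_pdivrMr// mulrAC mulrA ler_pdivlMr ?mulr_gt0//.
have : (x + t) * (x + t) <= 9 * (x * x) by nra.
move=> h; have := ler_wpM2l (ltW t0) h; nra.
Qed.

(** lam is the proportion of the dilations whose selector is 1. The errors telescope and phi takes
    values in [0, 1], so their sum over the block is at most 72 |f| wherever z lies. The order of
    the quantifiers matters: lam is chosen before f. *)
Lemma avg_selector n (z : disk R) : exists lam : R, 0 <= lam <= 1 /\
  forall f : bloch R,
    bloch_weight z * nrm (subspace_val (avg n f) z - lam%:C * f z : R[i]) <=
      72 / n.+1%:R * nrm f.
Proof.
have n0 : 0 < n.+1%:R :> R by [].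
have /choice[b bP] := fun k => @dilate_selector k z.
set t := 1 - _ in bP; have t0 : 0 < t := disk_dist_gt0 z.
pose phi := fun x : R => x / (x + t).
pose lam : R := n.+1%:R^-1 * \sum_(k < n.+1) (b (n.+1 + k)%N)%:R.
exists lam; split.
  apply/andP; split; first by rewrite mulr_ge0 ?invr_ge0 ?sumr_ge0.
  rewrite /lam mulrC ler_pdivrMr// mul1r.
  rewrite -[X in _ <= X%:R]card_ord -sumr_const ler_sum// => k _.
  by rewrite lern1 leq_b1.
move=> f; rewrite avgE.
have -> : lam%:C * f z = (n.+1%:R^-1)%:C *
    \sum_(k < n.+1) ((b (n.+1 + k)%N)%:R%:C * (f z : R[i])) :> R[i].
  by rewrite /lam rmorphM rmorph_sum /= -mulrA mulr_suml.
rewrite -mulrBr nrmM nrmR.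
rewrite ger0_norm ?invr_ge0 ?(ltW n0)// mulrCA [leRHS]mulrAC mulrC.
rewrite ler_wpM2r ?invr_ge0 ?(ltW n0)//.
rewrite -sumrB.
apply: (@le_trans _ _ (\sum_(k < n.+1)
    72 * (phi (2^-1 ^+ (n.+1 + k)) - phi (2^-1 ^+ (n.+1 + k).+1)) * nrm f)).
  apply: le_trans (ler_wpM2l (ltW (bloch_weight_gt0 z)) (nrm_sum _ _ _)) _.
  by rewrite mulr_sumr ler_sum// => k _; exact: bP.
rewrite -mulr_suml ler_wpM2r ?nrm_ge0// -mulr_sumr ler_piMr//.
have h0 m : 0 < 2^-1 ^+ m :> R by rewrite exprn_gt0.
have ht0 m : 0 < 2^-1 ^+ m + t by rewrite addr_gt0.
have phi0 m : 0 <= phi (2^-1 ^+ m) by apply: divr_ge0; exact: ltW.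
have phi1 m : phi (2^-1 ^+ m) <= 1.
  by rewrite /phi ler_pdivrMr// mul1r lerDl ltW.
rewrite -(big_mkord xpredT (fun k => phi (2^-1 ^+ (n.+1 + k)) - phi (2^-1 ^+ (n.+1 + k).+1))).
under eq_bigr do rewrite -opprB -addnS.
rewrite sumrN (telescope_sumr (fun k => phi (2^-1 ^+ (n.+1 + k))))// opprB addn0.
by rewrite lerBlDr (le_trans (phi1 _))// lerDl.
Qed.

Lemma avg_max n (f g : bloch R) :
  nrm (subspace_val (avg n f) + (g - subspace_val (avg n g))) <=
    Num.max (nrm f) (nrm g) + 72 / n.+1%:R * (nrm f + nrm g).
Proof.
apply: bloch_nrm_le => z; have w0 := bloch_weight_gt0 z.
have [lam [/andP[l0 l1] lamP]] := avg_selector n z.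
pose Kf := subspace_val (avg n f) z : R[i]; pose Kg := subspace_val (avg n g) z : R[i].
rewrite bloch_valD bloch_valB.
apply: (@le_trans _ _ (bloch_weight z * nrm (Kf + ((g z : R[i]) - Kg)))).
  exact: lexx.
(* Splits K f + g - K g into the two selector errors and the convex combination lam f + (1 - lam) g
   at z. *)
have alg (a b c d l : R[i]) :
  a + (c - b) = (a - l * d) - (b - l * c) + (l * d + (1 - l) * c) by ring.
have lamC : (1 - lam)%:C = 1 - lam%:C :> R[i].
  by rewrite rmorphB /= (rmorph1 (real_complex R)).
rewrite (alg _ _ _ (f z) lam%:C) -lamC.
have tri : nrm ((Kf - lam%:C * f z) - (Kg - lam%:C * g z) +
      (lam%:C * f z + (1 - lam)%:C * g z) : R[i]) <=
    nrm (Kf - lam%:C * f z) + nrm (Kg - lam%:C * g z) +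
    (lam * nrm (f z) + (1 - lam) * nrm (g z)).
  apply: le_trans (nrmD _ _) _; apply: lerD; first exact: nrmB.
  apply: le_trans (nrmD _ _) _.
  by rewrite !nrmM !nrmR !ger0_norm// subr_ge0.
apply: le_trans (ler_wpM2l (ltW w0) tri) _.
have := lamP f; have := lamP g; rewrite -/Kf -/Kg => Hg Hf.
have fm : bloch_weight z * nrm (f z) <= Num.max (nrm f) (nrm g).
  by rewrite le_max bloch_le_nrm.
have gm : bloch_weight z * nrm (g z) <= Num.max (nrm f) (nrm g).
  by rewrite le_max bloch_le_nrm orbT.
have Hm : lam * (bloch_weight z * nrm (f z)) + (1 - lam) * (bloch_weight z * nrm (g z))
    <= Num.max (nrm f) (nrm g).
  move: (Num.max _ _) (bloch_weight z * _) (bloch_weight z * _) fm gm => m x y.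
  by clear -l0 l1 => xm ym; nra.
rewrite mulrDr mulrDr [X in _ + X]mulrDr (mulrCA _ lam) (mulrCA _ (1 - lam)).
rewrite addrC lerD// mulrDr lerD//.
Qed.

End averages_M.

(** * M-ideals of compact operators *)

Section M_ideal_criterion.
Context {R : realType}.

Lemma bop_valD (X Y : normedModType R[i]) (S T : bop X Y) x : (S + T) x = S x + T x.
Proof. by []. Qed.

Lemma bop_valB (X Y : normedModType R[i]) (S T : bop X Y) x : (S - T) x = S x - T x.
Proof. by []. Qed.

Lemma bop_lincombE (X Y : normedModType R[i]) (a : R[i]) (S T : bop X Y) x :
  (a *: S + T) x = a *: S x + T x.
Proof. by []. Qed.

Lemma bop_ext (X Y : normedModType R[i]) (S T : bop X Y) : S =1 T -> S = T.
Proof. by move=> ST; apply/val_inj/funext. Qed.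

Lemma unimodular_rotation (c : R[i]) : exists2 a : R[i], nrm a = 1 & a * c = (nrm c)%:C.
Proof.
have [->|c0] := eqVneq c 0.
  by exists 1; rewrite ?nrm1// mulr0 nrm0.
exists ((nrm c)%:C / c); last by rewrite divfK.
by rewrite nrmM nrmV nrmR ger0_norm ?nrm_ge0// divff// gt_eqF ?nrm_gt0.
Qed.

(* The L-projection is P phi = lim_U phi o A_n along an ultrafilter U on nat:
   its kernel is the annihilator of J, and the estimate on A_n x + (y - A_n y)
   gives |P phi| + |phi - P phi| <= |phi|. *)
Lemma M_ideal_criterion (E : normedModType R[i]) (J : set E) (A : nat -> E -> E) :
  submod_closed [in J] -> closed J -> (forall n, linear (A n)) ->
  (forall n x, J (A n x)) ->
  (forall x (e : R), J x -> 0 < e ->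
    exists N, forall n, (N <= n)%N -> nrm (A n x - x) <= e) ->
  (forall x y (e : R), 0 < e -> exists N, forall n, (N <= n)%N ->
    nrm (A n x + (y - A n y)) <= Num.max (nrm x) (nrm y) + e) ->
  M_ideal J.
Proof.
move=> Jsub Jcl Alin JA Acvg Amax; split=> //.
have [U [UU Uoo]] := @ultraFilterLemma nat \oo _.
have UF : ProperFilter U by exact: ultra_proper.
have UN N (Q : set nat) : (forall n, (N <= n)%N -> Q n) -> U Q.
  by move=> NQ; apply: Uoo; exists N.
have A0 n : A n 0 = 0.
  have := Alin n 1 0 0; rewrite !scale1r addr0 => /eqP.
  by rewrite -subr_eq0 opprD addrA subrr sub0r oppr_eq0 => /eqP.
(* The case y = 0 of [Amax]: the maps are asymptotically contractive, which bounds phi (A_n x) along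
   [U] and keeps the limit functional within |phi|. *)
have Ale x (e : R) : 0 < e -> \forall n \near U, nrm (A n x) <= nrm x + e.
  move=> /(Amax x 0)[N hN]; apply: (UN N) => n /hN.
  by rewrite A0 subr0 addr0 nrm0 max_l ?nrm_ge0.
have phi_cvg (phi : dual E) : exists psi : dual E,
    forall x, (fun n => (phi : bop E R[i]^o) (A n x)) @ U --> (psi : bop E R[i]^o) x.
  pose ph : bop E R[i]^o := phi.
  have /choice[l hl] x : exists l : R[i]^o, (fun n => ph (A n x)) @ U --> l.
    apply: (@ultra_cvg _ _ _ _ (nrm ph * (nrm x + 1)) UU).
    apply: filterS (Ale x 1 ltr01) => n nx; apply: le_trans (bop_le_nrm _ _) _.
    by rewrite ler_wpM2l ?nrm_ge0.
  suff lP : l \in bop_pred by exists (Bop lP).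
  apply: (@bop_predP _ _ _ _ (nrm ph)) => [a x y|x].
    apply: (@cvg_unique _ _ ((fun n => ph (A n (a *: x + y))) @ U)).
    - exact: norm_hausdorff.
    - exact: hl.
    rewrite (_ : (fun n => _) = (fun n => a *: ph (A n x) + ph (A n y))).
      exact: cvg_lincomb.
    by apply/funext => n; rewrite Alin bop_linearP.
  apply/ler_addgt0Pr => e e0; have p1 : 0 < nrm ph + 1 by rewrite ltr_wpDl ?nrm_ge0.
  apply: nrm_cvg_le (hl x) _.
  apply: filterS (Ale x (e / (nrm ph + 1)) (divr_gt0 e0 p1)) => n nx.
  apply: le_trans (bop_le_nrm _ _) _.
  apply: le_trans (ler_wpM2l (nrm_ge0 _) nx) _; rewrite mulrDr lerD2l.
  by rewrite mulrA ler_pdivrMr// mulrC ler_wpM2l ?(ltW e0)// lerDl.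
have /choice[P PE] := phi_cvg.
have Puniq (phi psi : dual E) : (forall x, (fun n => (phi : bop E R[i]^o) (A n x)) @ U
    --> (psi : bop E R[i]^o) x) -> P phi = psi.
  move=> h; apply: bop_ext => x.
  apply: (@cvg_unique _ _ ((fun n => (phi : bop E R[i]^o) (A n x)) @ U)).
  - exact: norm_hausdorff.
  - exact: PE.
  exact: h.
have Plin (a : R[i]) (phi psi : dual E) : P (a *: phi + psi) = a *: P phi + P psi.
  apply: Puniq => x; rewrite bop_lincombE.
  rewrite (_ : (fun n => _) = (fun n => a *: (phi : bop E R[i]^o) (A n x) +
    (psi : bop E R[i]^o) (A n x))); last by apply/funext => n; rewrite bop_lincombE.
  by apply: cvg_lincomb; exact: PE.
have PD (phi psi : dual E) : P (phi + psi) = P phi + P psi.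
  by have := Plin 1 phi psi; rewrite !scale1r.
have Pann (psi : dual E) : annihilator J psi -> P psi = 0.
  move=> psiJ; apply: Puniq => x; rewrite (_ : (fun n => _) = cst 0).
    exact: cvg_cst.
  by apply/funext => n; exact: psiJ.
have annP (phi : dual E) : annihilator J (phi - P phi).
  move=> x Jx; rewrite bop_valB; apply/eqP; rewrite subr_eq0; apply/eqP.
  apply: (@cvg_unique _ _ ((fun n => (phi : bop E R[i]^o) (A n x)) @ U)).
  - exact: norm_hausdorff.
  - apply/cvg_nrmP => e e0; set ph : bop E R[i]^o := phi.
    have p1 : 0 < nrm ph + 1 by rewrite ltr_wpDl ?nrm_ge0.
    have [N hN] := Acvg x _ Jx (divr_gt0 e0 p1).
    apply: (UN N) => n /hN nx; rewrite -linearB.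
    apply: le_lt_trans (bop_le_nrm ph _) _; rewrite nrm_distC.
    apply: le_lt_trans (ler_wpM2l (nrm_ge0 _) nx) _.
    by rewrite mulrA ltr_pdivrMr// mulrC ltr_pM2l// ltrDl.
  exact: PE.
have PP (phi : dual E) : P (P phi) = P phi.
  by rewrite -[in RHS](subrK (P phi) phi) PD (Pann _ (annP phi)) add0r.
(* The complement V is the range of the projection P, described by its fixed points. *)
exists [set phi | P phi = phi]; split.
  split=> [|a phi psi]; rewrite !inE/=; first by apply: Pann => x _.
  by move=> Pphi Ppsi; rewrite Plin Pphi Ppsi.
move=> phi; exists (phi - P phi), (P phi); split.
- exact: annP.
- exact: PP.
- by rewrite subrK.
- apply/eqP; rewrite eq_le; apply/andP; split.
    by rewrite -{1}[phi](subrK (P phi)) nrmD.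
  pose ph : bop E R[i]^o := phi; pose v : bop E R[i]^o := P phi.
  pose j : bop E R[i]^o := phi - P phi.
  (* Unimodular factors make both values nonnegative reals, so that their moduli add. The sum is
     then the limit along [U] of phi at A_n x + (y - A_n y), a vector of norm at most 1 up to a
     small error. *)
  have key x y : nrm x <= 1 -> nrm y <= 1 -> nrm (v x) + nrm (j y) <= nrm ph.
    move=> x1 y1; apply/ler_addgt0Pr => e e0.
    have [a a1 av] := unimodular_rotation (v x).
    have [b b1 bj] := unimodular_rotation (j y).
    have -> : nrm (v x) + nrm (j y) = nrm (v (a *: x) + j (b *: y)).
      have -> : v (a *: x) + j (b *: y) = ((nrm (v x) + nrm (j y))%:C : R[i]^o).
        rewrite !linearZ/= rmorphD /=.
        exact: (congr2 (fun c d : R[i] => c + d) av bj).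
      by rewrite [RHS]nrmR ger0_norm// addr_ge0 ?nrm_ge0.
    have p1 : 0 < nrm ph + 1 by rewrite ltr_wpDl ?nrm_ge0.
    have [N hN] := Amax (a *: x) (b *: y) _ (divr_gt0 e0 p1).
    apply: (@nrm_cvg_le R R[i]^o _ U _
      (fun n => ph (A n (a *: x) + (b *: y - A n (b *: y))))).
      rewrite (_ : (fun n => _) = (fun n => ph (A n (a *: x)) +
          (ph (b *: y) - ph (A n (b *: y))))).
        apply: cvgD; first exact: PE.
        by rewrite bop_valB; apply: cvgB; [exact: cvg_cst|exact: PE].
      by apply/funext => n; rewrite linearD/= linearB.
    apply: (UN N) => n /hN nx; apply: le_trans (bop_le_nrm _ _) _.
    apply: le_trans (ler_wpM2l (nrm_ge0 _) nx) _.
    rewrite !nrmZ a1 b1 !mul1r.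
    have m1 : Num.max (nrm x) (nrm y) <= 1 by rewrite ge_max x1.
    apply: (@le_trans _ _ (nrm ph * (1 + e / (nrm ph + 1)))).
      by rewrite ler_wpM2l ?nrm_ge0// lerD2r.
    rewrite mulrDr mulr1 lerD2l mulrA ler_pdivrMr// mulrC.
    by rewrite ler_wpM2l ?(ltW e0)// lerDl.
  have vj y : nrm y <= 1 -> nrm v <= nrm ph - nrm (j y).
    move=> y1; apply: bop_nrm_le => x x1; rewrite lerBrDr; exact: key.
  rewrite -/ph -/v -/j -lerBrDr; apply: bop_nrm_le => y /vj; lra.
- move=> j' v' j'J Pv' phiE.
  have -> : P phi = v' by rewrite phiE PD (Pann _ j'J) add0r.
  by rewrite phiE addrK.
Qed.

End M_ideal_criterion.

(** * Compositions and compact operators into beta_0 *)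

Section compositions.
Context {R : realType}.

Lemma bop_comp_proof (X Y Z : normedModType R[i]) (T : bop Y Z) (S : bop X Y) :
  (T \o S : X -> Z) \in bop_pred.
Proof.
apply: (@bop_predP _ _ _ _ (nrm T * nrm S)) => [a x y|x] /=.
  by rewrite !bop_linearP.
apply: le_trans (bop_le_nrm _ _) _; rewrite -mulrA ler_wpM2l ?nrm_ge0//.
exact: bop_le_nrm.
Qed.

Definition bop_comp (X Y Z : normedModType R[i]) (T : bop Y Z) (S : bop X Y) :
  bop X Z := Bop (bop_comp_proof T S).

Lemma bop_compE (X Y Z : normedModType R[i]) (T : bop Y Z) (S : bop X Y) x :
  bop_comp T S x = T (S x).
Proof. by []. Qed.

Lemma bop_id_proof (X : normedModType R[i]) : (idfun : X -> X) \in bop_pred.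
Proof. by apply: (@bop_predP _ _ _ _ 1) => // x; rewrite mul1r. Qed.

Definition bop_id (X : normedModType R[i]) : bop X X := Bop (bop_id_proof X).

Lemma subspace_val_bop (Z : normedModType R[i]) (W : submodClosed Z) :
  (@subspace_val R Z W : subspace_of W -> Z) \in bop_pred.
Proof. by apply: (@bop_predP _ _ _ _ 1) => // x; rewrite mul1r. Qed.

Definition inclusion (Z : normedModType R[i]) (W : submodClosed Z) :
  bop (subspace_of W) Z := Bop (subspace_val_bop W).

Lemma tb_operator_comp (X Y Z : normedModType R[i]) (T : bop Y Z) (S : bop X Y) :
  tb_operator T -> tb_operator (bop_comp T S).
Proof.
have S1 : 0 < nrm S + 1 by rewrite ltr_wpDl ?nrm_ge0.
move=> /(totally_bounded_scale S1); apply: totally_boundedS => _ [x /= x1 <-].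
pose y := ((nrm S + 1)^-1)%:C *: S x.
exists (T y).
  exists y => //=; rewrite nrmZ nrmR gtr0_norm ?invr_gt0// mulrC ler_pdivrMr//.
  by rewrite mul1r (le_trans (bop_ball_le S x1))// lerDl.
rewrite -linearZ/= /y scalerA -rmorphM /= mulfV ?gt_eqF//.
by rewrite (rmorph1 (real_complex R)) scale1r.
Qed.

Lemma unit_ballE (X : normedModType R[i]) :
  [set x : X | `|x| <= 1] = [set x : X | nrm x <= 1].
Proof.
apply/seteqP; split=> x /=; rewrite nrm_leE (rmorph1 (real_complex R)); exact.
Qed.

(** The converse direction rests on [little_bloch_compact], hence the target beta_0. *)
Lemma compact_operatorP (X : normedModType R[i]) (S : bop X (little_bloch R)) :
  compact_operator S <-> tb_operator S.
Proof.
rewrite /compact_operator unit_ballE; split => [/compact_totally_bounded|Stb].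
  exact: totally_boundedS (@subset_closure _ _).
exact: little_bloch_compact.
Qed.

End compositions.

(* Y is either beta or beta_0; kappa embeds it into beta isometrically, and
   iota embeds beta_0 into it. *)
Section compact_operators_M_ideal.
Context {R : realType} {X Y : normedModType R[i]}.
Variables (iota : bop (little_bloch R) Y) (kappa : bop Y (bloch R)).
Hypothesis kappa_nrm : forall y, nrm (kappa y) = nrm y.
Hypothesis kappa_iota : forall f, kappa (iota f) = subspace_val f.
Hypothesis kappa_lift : forall y, vanishes_at_boundary (kappa y) ->
  exists f, iota f = y.

Let J : set (bop X Y) := [set T | exists2 S : bop X (little_bloch R),
  tb_operator S & forall x, T x = iota (S x)].

Let iota_inj f g : iota f = iota g -> f = g.
Proof. by move=> /(congr1 kappa); rewrite !kappa_iota => /val_inj. Qed.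

Let iota_nrm f : nrm (iota f) = nrm f.
Proof. by rewrite -kappa_nrm kappa_iota subspace_nrmE. Qed.

(** Preimages are chosen pointwise; injectivity of [iota] makes the choice linear and its isometry
    makes it bounded. *)
Let operator_lift (T : bop X Y) :
  (forall x, vanishes_at_boundary (kappa (T x))) ->
  exists S : bop X (little_bloch R), forall x, T x = iota (S x).
Proof.
move=> Tv; have /choice[S ST] x := kappa_lift (Tv x).
suff SP : S \in bop_pred by exists (Bop SP).
apply: (@bop_predP _ _ _ _ (nrm T)) => [a x y|x].
  by apply: iota_inj; rewrite bop_linearP !ST bop_linearP.
by rewrite -iota_nrm ST bop_le_nrm.
Qed.

Let J_submod_closed : submod_closed [in J].
Proof.
split=> [|a T T']; rewrite !inE/=.
  by exists 0; [exact: tb_operator0|move=> x; rewrite linear0].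
move=> [S Stb TS] [S' S'tb TS']; exists (a *: S + S').
  exact: tb_operator_lincomb.
by move=> x; rewrite !bop_lincombE TS TS' bop_linearP.
Qed.

(** The decay at the boundary passes to norm limits, so a limit operator lifts to beta_0. There its
    lift is a norm limit of totally bounded operators. *)
Let J_closed : closed J.
Proof.
move=> T /closure_nrmP TJ.
have Tv x : vanishes_at_boundary (kappa (T x)).
  move=> e e0; have e20 : 0 < e / 2 by rewrite divr_gt0.
  have x1 : 0 < nrm x + 1 by rewrite ltr_wpDl ?nrm_ge0.
  have [T' [S _ TS] TT'] := TJ _ (divr_gt0 e20 x1).
  have [r r1 Sr] := little_bloch_vanishes (S x) e20.
  exists r => // z /Sr Sz.
  have dT : nrm (kappa (T x) - subspace_val (S x)) <= e / 2.
    rewrite -kappa_iota -TS -linearB kappa_nrm -bop_valB.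
    apply: le_trans (bop_le_nrm _ _) _.
    move: TT'; rewrite ltr_pdivlMr// => /ltW; apply: le_trans.
    by rewrite ler_wpM2l ?nrm_ge0// lerDl.
  apply: (@le_lt_trans _ _ (bloch_weight z * (nrm (subspace_val (S x) z) +
      nrm (kappa (T x) z - subspace_val (S x) z)))).
    by rewrite ler_wpM2l ?nrm_dist_le// ltW// bloch_weight_gt0.
  rewrite mulrDr (splitr e) ltr_leD//.
  by rewrite -bloch_valB; exact: le_trans (bloch_le_nrm _ z) dT.
have [S TS] := operator_lift Tv; exists S => //.
apply: tb_operator_closed => e e0; have e20 : 0 < e / 2 by rewrite divr_gt0.
have [T' [S' S'tb TS'] TT'] := TJ _ e20; exists S' => //.
apply: (@le_lt_trans _ _ (e / 2)); last by rewrite ltr_pdivrMr// ltr_pMr// ltr1n.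
apply: bop_nrm_le => x x1; rewrite -iota_nrm bop_valB linearB/= -TS -TS'.
by rewrite -bop_valB (le_trans (bop_ball_le _ x1))// ltW.
Qed.

Let A n (T : bop X Y) : bop X Y := bop_comp iota (bop_comp (avg n) (bop_comp kappa T)).

Let A_linear n : linear (A n).
Proof.
move=> a T T'; apply: bop_ext => x.
by rewrite [RHS]bop_lincombE /A !bop_compE bop_lincombE !bop_linearP.
Qed.

Let A_J n T : J (A n T).
Proof.
exists (bop_comp (avg n) (bop_comp kappa T)); last by move=> x; rewrite /A bop_compE.
exact: (tb_operator_comp (bop_comp kappa T) (tb_avg n)).
Qed.

Let A_cvg (T : bop X Y) (e : R) : J T -> 0 < e ->
  exists N, forall n, (N <= n)%N -> nrm (A n T - T) <= e.
Proof.
move=> [S Stb TS] e0; have [N hN] := avg_cvg_operator Stb e0.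
exists N => n /hN Sn; apply: bop_nrm_le => x x1.
by rewrite bop_valB /A !bop_compE TS kappa_iota -linearB iota_nrm Sn.
Qed.

(** [avg_max] is applied to the images of each x of the unit ball; its error is at most 72 (|T| +
    |T'|) / (n + 1), uniformly in x. *)
Let A_max (T T' : bop X Y) (e : R) : 0 < e -> exists N, forall n, (N <= n)%N ->
  nrm (A n T + (T' - A n T')) <= Num.max (nrm T) (nrm T') + e.
Proof.
move=> e0; pose c := 72 * (nrm T + nrm T').
have c0 : 0 <= c by rewrite mulr_ge0// addr_ge0 ?nrm_ge0.
exists (Num.truncn (c / e)) => n Nn.
have cn : c / n.+1%:R <= e.
  rewrite ler_pdivrMr// mulrC -ler_pdivrMr// ltW//.
  by apply: lt_le_trans (truncnS_gt _) _; rewrite ler_nat.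
apply: bop_nrm_le => x x1; rewrite bop_valD bop_valB /A !bop_compE -kappa_nrm.
rewrite linearD linearB/= !kappa_iota; apply: le_trans (avg_max _ _ _) _.
have Tx : nrm (kappa (T x)) <= nrm T by rewrite kappa_nrm bop_ball_le.
have T'x : nrm (kappa (T' x)) <= nrm T' by rewrite kappa_nrm bop_ball_le.
apply: lerD.
  by rewrite ge_max !le_max Tx T'x orbT.
apply: le_trans cn; rewrite /c [leRHS]mulrAC; apply: ler_wpM2l; first by rewrite divr_ge0.
exact: lerD.
Qed.

Lemma tb_operators_M_ideal : M_ideal J.
Proof. exact: M_ideal_criterion A_linear A_J A_cvg A_max. Qed.

End compact_operators_M_ideal.

Lemma compact_operators_little_bloch_M_ideal (R : realType) :
  M_ideal (compact_operators (little_bloch R) (little_bloch R)).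
Proof.
have -> : compact_operators (little_bloch R) (little_bloch R) =
    [set T | exists2 S : bop (little_bloch R) (little_bloch R),
       tb_operator S & forall x, T x = bop_id (little_bloch R) (S x)].
  apply/seteqP; split=> [T Tc|T [S Stb TS]].
    by exists T => //; exact/compact_operatorP.
  by apply/compact_operatorP; rewrite (_ : T = S)//; exact: bop_ext.
apply: (tb_operators_M_ideal (kappa := inclusion (little_bloch_pred R))) => //.
by move=> f _; exists f.
Qed.

Lemma compact_operators_bloch_M_ideal (R : realType) (X : normedModType R[i]) :
  M_ideal (@compact_operators_little_bloch R X).
Proof.
have -> : @compact_operators_little_bloch R X =
    [set T | exists2 S : bop X (little_bloch R), tb_operator S &
       forall x, T x = inclusion (little_bloch_pred R) (S x)].
  by apply/seteqP; split=> T [S Sc TS]; exists S => //; exact/compact_operatorP.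
apply: (tb_operators_M_ideal (kappa := bop_id (bloch R))) => //.
move=> f fv; suff fP : f \in little_bloch_pred R by exists (SubspaceOf fP).
by rewrite inE.
Qed.

Theorem corollary5p9 (R : realType) :
  embeds_almost_isometrically (little_bloch R) (c0 R) /\
  M_ideal (compact_operators (little_bloch R) (little_bloch R)) /\
  (forall X : completeNormedModType R[i],
     M_ideal (compact_operators_little_bloch X)).
Proof.
split; first exact: little_bloch_embeds_c0.
split; first exact: compact_operators_little_bloch_M_ideal.
by move=> X; exact: compact_operators_bloch_M_ideal.
Qed.
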